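(* Let $N>0$ be an integer and let $\alpha\geq 0$. Assume that there exist symmetric positive definite matrices $P_N\in\mathbb{S}^{n+2+2(N+1)}_+$ and $R,S\in\mathbb{S}^2_+$ such that the linear matrix inequality $$\Psi_{N,\alpha}-c\,R_N\prec 0$$ holds, where (writing $\mathrm{He}(M)=M+M^\top$) $$\Psi_{N,\alpha}=\mathrm{He}\big((Z_N+\alpha F_N)^\top P_N F_N\big)-c\,G_N^\top S\,G_N+c\,H_N^\top(S+R)H_N\,e^{2\alpha/c},$$ $$F_N=\begin{bmatrix} I_{n+2+2(N+1)} & 0_{n+2+2(N+1),\,2}\end{bmatrix},\qquad Z_N=\begin{bmatrix}\mathcal{N}_N\\ \mathcal{Z}_N\end{bmatrix},$$ $$\mathcal{N}_N=\begin{bmatrix}\tilde A & 0_{n+2,\,2(N+1)} & \tilde B\begin{bmatrix}G\\ H\end{bmatrix}\end{bmatrix},\qquad \mathcal{Z}_N=c\,\mathbb{1}_N H_N-c\,\bar{\mathbb{1}}_N G_N-c\begin{bmatrix}0_{2(N+1),\,n+2} & L_N & 0_{2(N+1),\,2}\end{bmatrix},$$ $$G_N=\begin{bmatrix}\begin{matrix}-cg\,C_1\\ 0_{1,n+2}\end{matrix} & 0_{2,\,2(N+1)} & G\end{bmatrix},\qquad G=\begin{bmatrix}0&1+cg\\ 1+ck&0\end{bmatrix},$$ $$H_N=\begin{bmatrix}\begin{matrix}0_{1,n+2}\\ cg\,C_1\end{matrix} & 0_{2,\,2(N+1)} & H\end{bmatrix},\qquad H=\begin{bmatrix}1-ck&0\\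 0&1-cg\end{bmatrix},$$ $$R_N=\mathrm{diag}\big(0_{n+2},\,R,\,3R,\,\dots,\,(2N+1)R,\,0_2\big),$$ $$L_N=\begin{bmatrix}\ell_{0,0}I_2&\cdots&0_2\\ \vdots&\ddots&\vdots\\ \ell_{N,0}I_2&\cdots&\ell_{N,N}I_2\end{bmatrix},\qquad \mathbb{1}_N=\begin{bmatrix}I_2\\ \vdots\\ I_2\end{bmatrix},\qquad \bar{\mathbb{1}}_N=\begin{bmatrix}I_2\\ -I_2\\ \vdots\\ (-1)^N I_2\end{bmatrix},$$ with $\ell_{k,j}=(2j+1)\big(1-(-1)^{j+k}\big)$ if $j\leq k$ and $\ell_{k,j}=0$ otherwise ($0\leq k,j\leq N$; $\mathbb{1}_N$ and $\bar{\mathbb{1}}_N$ have $N+1$ blocks). Then the coupled system $$\begin{cases}\chi_t(x,t)=c\,\chi_x(x,t), & x\in(0,1),\ t>0,\\ \begin{bmatrix}1-cg&0\\ 0&1-ck\end{bmatrix}\chi(0,t)=\begin{bmatrix}0&1+cg\\ 1+ck&0\end{bmatrix}\chi(1,t)-\begin{bmatrix}2cg\,C_1X(t)\\ 0\end{bmatrix}, & t\geq 0,\\ \dot X(t)=\tilde A X(t)+\tilde B\begin{bmatrix}\chi(0,t)\\ \chi(1,t)\end{bmatrix}, & t\geq 0,\end{cases}$$ is $\alpha$-exponentially stable with respect to $\|\cdot\|_{\mathcal H}$.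
   Context: Data: $c>0$, $g,k\in\mathbb{R}$, an integer $n\geq 0$, scalars $A_{21},A_{22},b,e_1\in\mathbb{R}$, and matrices $A=\begin{bmatrix}0&1\\ A_{21}&A_{22}\end{bmatrix}$, $B=\begin{bmatrix}0\\ b\end{bmatrix}$, $E_1=\begin{bmatrix}0\\ e_1\end{bmatrix}$, $A_c\in\mathbb{R}^{n\times n}$, $B_{c1},B_{c2}\in\mathbb{R}^{n\times 2}$, $C_1\in\mathbb{R}^{1\times(n+2)}$, $C_2\in\mathbb{R}^{1\times n}$, $K\in\mathbb{R}^{1\times 2}$. Set $$\tilde A=\begin{bmatrix}A_c&B_{c1}\\ BC_2&A+BK\end{bmatrix}\in\mathbb{R}^{(n+2)\times(n+2)},\qquad \tilde B=\frac12\begin{bmatrix}B_{c2}\\ \begin{matrix}0_{2,1}&E_1\end{matrix}\end{bmatrix}\begin{bmatrix}1&0&0&1\\ 0&1&1&0\end{bmatrix}\in\mathbb{R}^{(n+2)\times 4}.$$ The state is $(X,\chi)$ with $X(t)\in\mathbb{R}^{n+2}$ and $\chi(\cdot,t):[0,1]\to\mathbb{R}^2$; initial conditions are $X(0)=X^0$, $\chi(\cdot,0)=\chi_0$. Notation: $\mathbb{S}^m_+$ is the set of symmetric positive definite $m\times m$ real matrices; $\prec 0$ means negative definite; $I_m$ is the identity, $0_{p,q}$ the $p\times q$ zero matrix, $0_m=0_{m,m}$; $\mathrm{diag}$ denotes block-diagonal matrices; $\|\cdot\|$ is the $L^2(0,1)$ norm. Function spaces: $\mathcal{H}=\mathbb{R}^{n+2}\times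 L^2(0,1)\times L^2(0,1)$ and $\mathcal{H}^1=\mathbb{R}^{n+2}\times H^1(0,1)\times H^1(0,1)$, with norm $\|(X,\chi)\|_{\mathcal H}^2=|X|^2+\frac12\|\chi\|^2$ on $\mathcal H$. The domain is $$\mathcal{D}(T)=\left\{(X,\chi)\in\mathcal{H}^1:\ \begin{bmatrix}1-cg&0\\ 0&1-ck\end{bmatrix}\chi(0)=\begin{bmatrix}0&1+cg\\ 1+ck&0\end{bmatrix}\chi(1)-\begin{bmatrix}2cg\,C_1X\\ 0\end{bmatrix}\right\},$$ and solutions are considered for initial data $(X^0,\chi_0)\in\mathcal{D}(T)$ (strong solutions, $(X,\chi)\in C([0,\infty);\mathcal D(T))\cap C^1([0,\infty);\mathcal H)$). Definition ($\alpha$-exponential stability): the system is $\alpha$-stable (exponentially stable with decay rate at least $\alpha$) with respect to $\|\cdot\|_{\mathcal H}$ if there exists $\gamma\geq 1$ such that, for every initial condition $(X^0,\chi_0)$, the solution satisfies $\|(X(t),\chi(\cdot,t))\|_{\mathcal H}\leq\gamma\,\|(X^0,\chi_0)\|_{\mathcal H}\,e^{-\alpha t}$ for all $t\geq 0$. *)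

(* Defs.v *)
From mathcomp Require Import all_boot all_order all_algebra.
From mathcomp Require Import all_classical all_reals all_analysis.

Set Implicit Arguments.
Unset Strict Implicit.
Unset Printing Implicit Defensive.

Import Order.TTheory GRing.Theory Num.Theory.
Import numFieldNormedType.Exports.

Local Open Scope classical_set_scope.
Local Open Scope ring_scope.

Section Matrices.
Variable R : realType.

Definition posdef m (Q : 'M[R]_m) : Prop :=
  Q^T = Q /\ forall v : 'cV[R]_m, v != 0 -> 0 < (v^T *m Q *m v) 0 0.

Definition negdef m (Q : 'M[R]_m) : Prop := posdef (- Q).

Definition He m (M : 'M[R]_m) : 'M[R]_m := M + M^T.

Definition mx_rows m n (rows : seq (seq R)) : 'M[R]_(m, n) :=
  \matrix_(i < m, j < n) nth 0 (nth [::] rows i) j.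

End Matrices.

Section System.
Variables (R : realType) (n : nat).

Definition tildeA (A21 A22 b : R) (Ac : 'M[R]_n) (Bc1 : 'M[R]_(n, 2))
    (C2 : 'rV[R]_n) (K : 'rV[R]_2) : 'M[R]_(n + 2) :=
  let A : 'M[R]_2 := mx_rows 2 2 [:: [:: 0; 1]; [:: A21; A22]] in
  let B : 'cV[R]_2 := mx_rows 2 1 [:: [:: 0]; [:: b]] in
  block_mx Ac Bc1 (B *m C2) (A + B *m K).

Definition tildeB (e1 : R) (Bc2 : 'M[R]_(n, 2)) : 'M[R]_(n + 2, 2 + 2) :=
  let E1 : 'cV[R]_2 := mx_rows 2 1 [:: [:: 0]; [:: e1]] in
  2^-1 *: (col_mx Bc2 (row_mx (0 : 'cV[R]_2) E1)
           *m mx_rows 2 (2 + 2) [:: [:: 1; 0; 0; 1]; [:: 0; 1; 1; 0]]).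

Section LMI.
Variables (c g k : R) (C1 : 'rV[R]_(n + 2)).
Variables (At : 'M[R]_(n + 2)) (Bt : 'M[R]_(n + 2, 2 + 2)).
Variable N : nat.

(* This is 2 * (N + 1), in the form in which [\mxblock] indexes N + 1 blocks
   of size 2. *)
Definition dimproj : nat := (\sum_(i < N.+1) 2)%N.

Definition dimxi : nat := (n + 2 + dimproj + 2)%N.

Definition mxG : 'M[R]_2 :=
  mx_rows 2 2 [:: [:: 0; 1 + c * g]; [:: 1 + c * k; 0]].

Definition mxH : 'M[R]_2 :=
  mx_rows 2 2 [:: [:: 1 - c * k; 0]; [:: 0; 1 - c * g]].

Definition G_ : 'M[R]_(2, dimxi) :=
  row_mx (row_mx (col_mx (- (c * g) *: C1) (0 : 'rV[R]_(n + 2)))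
                 (0 : 'M[R]_(2, dimproj))) mxG.

Definition H_ : 'M[R]_(2, dimxi) :=
  row_mx (row_mx (col_mx (0 : 'rV[R]_(n + 2)) ((c * g) *: C1))
                 (0 : 'M[R]_(2, dimproj))) mxH.

Definition ell (i j : nat) : R :=
  if (j <= i)%N then (2 * j + 1)%:R * (1 - (-1) ^+ (j + i)) else 0.

Definition L_ : 'M[R]_dimproj :=
  \mxblock_(i < N.+1, j < N.+1) ((ell i j)%:M : 'M[R]_2).

Definition ones_ : 'M[R]_(dimproj, 2) :=
  \mxcol_(i < N.+1) (1%:M : 'M[R]_2).

Definition altones_ : 'M[R]_(dimproj, 2) :=
  \mxcol_(i < N.+1) (((-1) ^+ i)%:M : 'M[R]_2).

Definition R_ (Rm : 'M[R]_2) : 'M[R]_dimxi :=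
  let proj : 'M[R]_dimproj := \mxdiag_(i < N.+1) ((2 * i + 1)%:R *: Rm) in
  block_mx (block_mx (0 : 'M[R]_(n + 2)) 0 0 proj) 0 0 (0 : 'M[R]_2).

Definition F_ : 'M[R]_(n + 2 + dimproj, dimxi) :=
  row_mx 1%:M (0 : 'M[R]_(n + 2 + dimproj, 2)).

Definition Z_ : 'M[R]_(n + 2 + dimproj, dimxi) :=
  let ZX : 'M[R]_(n + 2, dimxi) :=
    row_mx (row_mx At (0 : 'M[R]_(n + 2, dimproj))) (Bt *m col_mx mxG mxH) in
  let Zproj : 'M[R]_(dimproj, dimxi) :=
    c *: (ones_ *m H_) - c *: (altones_ *m G_)
    - c *: row_mx (row_mx (0 : 'M[R]_(dimproj, n + 2)) L_)
                  (0 : 'M[R]_(dimproj, 2)) in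
  col_mx ZX Zproj.

Definition Psi_ (alpha : R) (P : 'M[R]_(n + 2 + dimproj)) (Rm Sm : 'M[R]_2)
    : 'M[R]_dimxi :=
  He ((Z_ + alpha *: F_)^T *m P *m F_)
  - c *: (G_^T *m Sm *m G_)
  + (c * expR (2 * alpha / c)) *: (H_^T *m (Sm + Rm) *m H_).

End LMI.

(* Functions [0, 1] -> R^2 are represented by functions on R of which only the
   values on [0, 1] are used. *)
Section Spaces.
Local Notation mu := (@lebesgue_measure R).
Local Notation I01 := (`[(0 : R)%R, (1 : R)%R]%classic : set R).
Implicit Types (c g k : R) (X : 'cV[R]_(n + 2)) (f df : R -> 'cV[R]_2).

Definition isL2 f : Prop := forall i : 'I_2,
  measurable_fun I01 (fun x => f x i 0) /\
  (\int[mu]_(x in I01) ((f x i 0) ^+ 2)%:E < +oo)%E.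

Definition sqnorm m (v : 'cV[R]_m) : R := \sum_(i < m) v i 0 ^+ 2.

(* [Rintegral] is 0 when the integral is infinite: to be used with [isL2]. *)
Definition L2norm f : R :=
  Num.sqrt (\int[mu]_(x in I01) sqnorm (f x)).

Definition Hnorm X f : R := Num.sqrt (sqnorm X + 2^-1 * L2norm f ^+ 2).

(* f is the absolutely continuous representative of an element of
   H^1(0,1) x H^1(0,1), with derivative df; this is the representative whose
   values f 0 and f 1 enter the boundary condition. Such an f is bounded on
   [0, 1], hence in L^2. *)
Definition H1_deriv f df : Prop :=
  isL2 df /\ forall (x : R) (i : 'I_2), 0 <= x <= 1 ->
    f x i 0 = f 0 i 0 + \int[mu]_(y in `[0, x]) df y i 0.

Definition H1norm X f df : R := Num.sqrt (Hnorm X f ^+ 2 + L2norm df ^+ 2).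

Definition boundary c g k (C1 : 'rV[R]_(n + 2)) X f : Prop :=
  mx_rows 2 2 [:: [:: 1 - c * g; 0]; [:: 0; 1 - c * k]] *m f 0
  = mxG c g k *m f 1
    - col_mx ((2 * c * g) *: (C1 *m X)) (0 : 'M[R]_1).

Definition domT c g k (C1 : 'rV[R]_(n + 2)) X f : Prop :=
  (exists df, H1_deriv f df) /\ boundary c g k C1 X f.

End Spaces.

Section Solutions.
Local Notation mu := (@lebesgue_measure R).
Local Notation time := [set t : R | 0 <= t].
Implicit Types c g k alpha : R.

(* (X, f) in C^0([0, +oo); H) *)
Definition Hcontinuous (X : R -> 'cV[R]_(n + 2)) (f : R -> R -> 'cV[R]_2) :=
  (forall t : R, 0 <= t -> isL2 (f t)) /\
  forall t0 : R, 0 <= t0 ->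
    Hnorm (X t - X t0) (fun x => f t x - f t0 x)
      @[t --> within time (nbhs t0)] --> (0 : R).

(* (X, f) in C^0([0, +oo); H^1), where fx t is the derivative of f t *)
Definition H1continuous (X : R -> 'cV[R]_(n + 2))
    (f fx : R -> R -> 'cV[R]_2) :=
  (forall t : R, 0 <= t -> H1_deriv (f t) (fx t)) /\
  forall t0 : R, 0 <= t0 ->
    H1norm (X t - X t0) (fun x => f t x - f t0 x) (fun x => fx t x - fx t0 x)
      @[t --> within time (nbhs t0)] --> (0 : R).

(* (dX, df) is the time derivative of (X, f) in H, one-sided at t = 0. *)
Definition Hderivative (X dX : R -> 'cV[R]_(n + 2))
    (f df : R -> R -> 'cV[R]_2) :=
  forall t0 : R, 0 <= t0 ->
    Hnorm ((t - t0)^-1 *: (X t - X t0) - dX t0)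
          (fun x => (t - t0)^-1 *: (f t x - f t0 x) - df t0 x)
      @[t --> within time (dnbhs t0)] --> (0 : R).

(* (X, chi) in C^0([0, +oo); D(T)) /\ C^1([0, +oo); H) satisfies the coupled
   system; the boundary condition is part of [domT]. *)
Definition strong_solution c g k (C1 : 'rV[R]_(n + 2)) (At : 'M[R]_(n + 2))
    (Bt : 'M[R]_(n + 2, 2 + 2))
    (X : R -> 'cV[R]_(n + 2)) (chi : R -> R -> 'cV[R]_2) : Prop :=
  exists (chi_x chi_t : R -> R -> 'cV[R]_2) (dX : R -> 'cV[R]_(n + 2)),
    [/\ (forall t : R, 0 <= t -> domT c g k C1 (X t) (chi t))
        /\ H1continuous X chi chi_x,
        Hderivative X dX chi chi_t /\ Hcontinuous dX chi_t,
        forall t : R, 0 < t ->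
          {ae mu, forall x, x \in `]0, 1[ -> chi_t t x = c *: chi_x t x}
      & forall t : R, 0 <= t ->
          dX t = At *m X t + Bt *m col_mx (chi t 0) (chi t 1)].

Definition exp_stable c g k (C1 : 'rV[R]_(n + 2)) (At : 'M[R]_(n + 2))
    (Bt : 'M[R]_(n + 2, 2 + 2)) alpha : Prop :=
  exists2 gamma : R, 1 <= gamma &
    forall (X0 : 'cV[R]_(n + 2)) (chi0 : R -> 'cV[R]_2),
      domT c g k C1 X0 chi0 ->
    forall (X : R -> 'cV[R]_(n + 2)) (chi : R -> R -> 'cV[R]_2),
      strong_solution c g k C1 At Bt X chi ->
      X 0 = X0 -> (forall x : R, 0 <= x <= 1 -> chi 0 x = chi0 x) ->
    forall t : R, 0 <= t ->
      Hnorm (X t) (chi t) <= gamma * Hnorm X0 chi0 * expR (- (alpha * t)).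

End Solutions.
End System.

(* Main.v *)
Require Import Defs.
From mathcomp Require Import all_boot all_order all_algebra.
From mathcomp Require Import all_classical all_reals all_analysis.
From mathcomp Require Import measurable_realfun.
From mathcomp Require Import ring lra zify.

(** The proof is a Lyapunov argument. Put a = 2 alpha / c, let L_k be the k-th
    Legendre polynomial transported to [0, 1], and let Xi collect the moments
    Xi_k = int chi L_k, k <= N. The functional is
      V(X, chi) = v^T P v + int_0^1 e^(a x) chi^T (S + x R) chi dx,
    with v = (X, Xi).

    Size of V. A positive definite matrix is coercive [posdef_coercive] and
    Xi is controlled by chi through Cauchy-Schwarz, so V lies between two
    positive multiples of the squared norm of (X, chi) [lyapunov_ge],
    [lyapunov_le].

    Decay of V. Let w be the vector of midpoints of the traces of chi
    [midpoint] and xi = (X, Xi, w). By the boundary condition, G xi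
    and H xi are the traces chi(0) and chi(1) [boundary_G], [boundary_H].
    Legendre polynomials take the values (-1)^k and 1 at the endpoints, and
    their derivatives expand with the coefficients l_(k,j) [deriv_legendre].
    Integrating by parts the moments of chi_t = c chi_x then gives v' = Z xi
    [Xi_space_derivative], [Z_augmented]. Integrating by parts the distributed
    term leaves
      c e^a chi(1)^T (S + R) chi(1) - c chi(0)^T S chi(0)
        - 2 alpha int e^(a x) chi^T (S + x R) chi - c int e^(a x) chi^T R chi,
    and the last integral is at least int chi^T R chi because a >= 0, hence at
    least sum_k (2 k + 1) Xi_k^T R Xi_k = xi^T R_N xi by the Bessel inequality
    for the Legendre family [energy_bessel]. Altogether
      V' + 2 alpha V <= xi^T (Psi - c R_N) xi <= 0
    [lyapunov_deriv_le], so V(t) <= e^(- 2 alpha t) V(0) [exponential_decay].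

    The analytic work is to justify this for strong solutions. The time
    derivative only exists in L2, which is enough to differentiate every
    pairing int u v of two curves [inner_tderiv]. In space, chi is merely
    absolutely continuous; integration by parts holds because the defect of the
    formula is continuous for the L1 norm of the derivatives and vanishes when
    these are continuous [parts_defect_eq0]. *)

Set Implicit Arguments.
Unset Strict Implicit.
Unset Printing Implicit Defensive.

Import Order.TTheory GRing.Theory Num.Theory.
Import numFieldNormedType.Exports.

Local Open Scope classical_set_scope.
Local Open Scope ring_scope.

(** * Square-integrable functions on the unit interval *)

Section SquareIntegrable.
Variable R : realType.
Local Notation mu := (@lebesgue_measure R).
Local Notation I01 := (`[(0 : R)%R, (1 : R)%R]%classic : set R).
Implicit Types f g h u v : R -> R.

(** A nonnegative quadratic polynomial in [s] has nonpositive discriminant; both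
    Cauchy-Schwarz inequalities below, for L2 and for positive definite
    matrices, come from it. *)
Lemma discriminant_le (a b d : R) : 0 <= d ->
  (forall s, 0 <= a + 2 * s * b + s ^+ 2 * d) -> b ^+ 2 <= a * d.
Proof.
move=> d0 h.
have [d1|d1] := eqVneq d 0.
  move: h; rewrite {}d1 mulr0 => h.
  have [-> //|b0] := eqVneq b 0; first by rewrite expr0n.
  (* The polynomial is affine with slope 2 b: at this point it equals -1. *)
  have := h (- (a + 1) / (2 * b)).
  rewrite mulr0 addr0 (_ : 2 * _ * b = - (a + 1)); first by lra.
  by field.
have {d1} d0 : 0 < d by rewrite lt_def d1.
(* The minimizer of the polynomial. *)
have := h (- b / d).
rewrite (_ : a + _ + _ = (a * d - b ^+ 2) / d); last by field; rewrite gt_eqF.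
by rewrite pmulr_lge0 ?invr_gt0// subr_ge0.
Qed.

Lemma measurable_I01 : measurable (I01 : set (measurableTypeR R)).
Proof. exact: measurable_itv. Qed.
Local Hint Resolve measurable_I01 : core.

Definition L2 f : Prop := measurable_fun I01 f /\
  (\int[mu]_(x in I01) ((f x) ^+ 2)%:E < +oo)%E.

Definition inner f g : R := \int[mu]_(x in I01) (f x * g x).

Lemma L2_sqr_integrable f : L2 f -> mu.-integrable I01 (EFin \o (fun x => f x ^+ 2)).
Proof.
move=> [mf fi]; apply/integrableP; split.
  by apply/measurable_EFinP; exact: measurable_funX.
move: fi; congr (_ < _)%E; apply: eq_integral => x _ /=.
by rewrite ger0_norm// sqr_ge0.
Qed.

Lemma sqr_integrable_L2 f : measurable_fun I01 f ->
  mu.-integrable I01 (EFin \o (fun x => f x ^+ 2)) -> L2 f.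
Proof. by move=> mf fi; split => //; exact: integrable_lty fi. Qed.

Lemma L2_mul_integrable f g : L2 f -> L2 g ->
  mu.-integrable I01 (EFin \o (fun x => f x * g x)).
Proof.
move=> Lf Lg.
have := integrableD measurable_I01 (L2_sqr_integrable Lf) (L2_sqr_integrable Lg).
apply: le_integrable => //.
  by apply/measurable_EFinP/measurable_funM; [case: Lf|case: Lg].
move=> x _ /=; rewrite lee_fin normrM [leRHS]ger0_norm; last first.
  by rewrite addr_ge0// sqr_ge0.
rewrite -(real_normK (num_real (f x))) -(real_normK (num_real (g x))).
have := sqr_ge0 (`|f x| - `|g x|).
have := mulr_ge0 (normr_ge0 (f x)) (normr_ge0 (g x)).
nra.
Qed.

Lemma L2D f g : L2 f -> L2 g -> L2 (fun x => f x + g x).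
Proof.
move=> Lf Lg; apply: sqr_integrable_L2.
  by apply: measurable_funD; [case: Lf|case: Lg].
have := integrableD measurable_I01
  (integrableD measurable_I01 (L2_sqr_integrable Lf) (L2_sqr_integrable Lg))
  (integrableZl measurable_I01 2 (L2_mul_integrable Lf Lg)).
apply: eq_integrable => // x _ /=.
by rewrite -!EFinD; congr EFin; ring.
Qed.

Lemma bounded_mul_L2 f h (M : R) : measurable_fun I01 h ->
  (forall x, 0 <= x <= 1 -> `|h x| <= M) -> L2 f -> L2 (fun x => h x * f x).
Proof.
move=> mh hM Lf; apply: sqr_integrable_L2.
  by apply: measurable_funM => //; case: Lf.
have := integrableZl measurable_I01 (M ^+ 2) (L2_sqr_integrable Lf).
apply: le_integrable => //.
  apply/measurable_EFinP/measurable_funX/measurable_funM => //; by case: Lf.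
move=> x; rewrite /= in_itv/= => x01; rewrite lee_fin.
rewrite -exprMn !normrX ler_pXn2r ?nnegrE// !normrM ler_wpM2r//.
by rewrite (le_trans (hM x x01))// ler_norm.
Qed.

Lemma L2_bounded f (M : R) : measurable_fun I01 f ->
  (forall x, 0 <= x <= 1 -> `|f x| <= M) -> L2 f.
Proof.
move=> mf fM; apply: sqr_integrable_L2 => //.
have muI : (mu I01 < +oo)%E.
  by rewrite lebesgue_measure_itv/= lte_fin ltr01 -EFinD ltry.
apply: measurable_bounded_integrable => //; first exact: measurable_funX.
exists (M ^+ 2); split; first exact: num_real.
move=> y My x /=; rewrite in_itv/= => x01.
rewrite /= normrX (le_trans _ (ltW My))// ler_pXn2r ?nnegrE//; first exact: fM.
exact: le_trans (normr_ge0 _) (fM x x01).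
Qed.

Lemma L2_cst (a : R) : L2 (fun=> a).
Proof. exact: (@L2_bounded _ `|a|). Qed.

Lemma L2Z (a : R) f : L2 f -> L2 (fun x => a * f x).
Proof. exact: (@bounded_mul_L2 _ (fun=> a) `|a|). Qed.

Lemma L2B f g : L2 f -> L2 g -> L2 (fun x => f x - g x).
Proof.
move=> Lf /(L2Z (-1)) Lg.
rewrite (_ : (fun x => _) = (fun x => f x + (-1) * g x)); first exact: L2D.
by apply/funext => x; rewrite mulN1r.
Qed.

Lemma L2_sum (I : Type) (s : seq I) (F : I -> R -> R) :
  (forall i, L2 (F i)) -> L2 (fun x => \sum_(i <- s) F i x).
Proof.
move=> LF; elim: s => [|i s IH].
  rewrite (_ : (fun x => _) = (fun=> 0)); first exact: L2_cst.
  by apply/funext => x; rewrite big_nil.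
rewrite (_ : (fun x => _) = (fun x => F i x + \sum_(i <- s) F i x)).
  exact: L2D.
by apply/funext => x; rewrite big_cons.
Qed.

Lemma eq_inner f g u v : (forall x, 0 <= x <= 1 -> f x * g x = u x * v x) ->
  inner f g = inner u v.
Proof.
move=> e; apply: eq_Rintegral => x; rewrite inE /= in_itv/= => x01; exact: e.
Qed.

Lemma innerC f g : inner f g = inner g f.
Proof. by apply: eq_inner => x _; rewrite mulrC. Qed.

Lemma innerDl f g u : L2 f -> L2 g -> L2 u ->
  inner (fun x => f x + g x) u = inner f u + inner g u.
Proof.
move=> Lf Lg Lu; rewrite /inner -RintegralD//; try exact: L2_mul_integrable.
by apply: eq_Rintegral => x _; rewrite mulrDl.
Qed.

Lemma innerZl (a : R) f u : L2 f -> L2 u -> inner (fun x => a * f x) u = a * inner f u.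
Proof.
move=> Lf Lu; rewrite /inner -RintegralZl//; try exact: L2_mul_integrable.
by apply: eq_Rintegral => x _; rewrite mulrA.
Qed.

Lemma innerBl f g u : L2 f -> L2 g -> L2 u ->
  inner (fun x => f x - g x) u = inner f u - inner g u.
Proof.
move=> Lf Lg Lu; rewrite /inner -RintegralB//; try exact: L2_mul_integrable.
by apply: eq_Rintegral => x _; rewrite mulrBl.
Qed.

Lemma innerDr f g u : L2 f -> L2 g -> L2 u ->
  inner u (fun x => f x + g x) = inner u f + inner u g.
Proof. by move=> Lf Lg Lu; rewrite innerC innerDl// (innerC f) (innerC g). Qed.

Lemma innerZr (a : R) f u : L2 f -> L2 u -> inner u (fun x => a * f x) = a * inner u f.
Proof. by move=> Lf Lu; rewrite innerC innerZl// (innerC f). Qed.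

Lemma innerBr f g u : L2 f -> L2 g -> L2 u ->
  inner u (fun x => f x - g x) = inner u f - inner u g.
Proof. by move=> Lf Lg Lu; rewrite innerC innerBl// (innerC f) (innerC g). Qed.

Lemma inner_suml (I : Type) (s : seq I) (F : I -> R -> R) u :
  (forall i, L2 (F i)) -> L2 u ->
  inner (fun x => \sum_(i <- s) F i x) u = \sum_(i <- s) inner (F i) u.
Proof.
move=> LF Lu; elim: s => [|i s IH].
  rewrite big_nil (_ : inner _ _ = inner (fun=> 0 * 0) u).
    by rewrite (innerZl 0 (L2_cst 0) Lu) mul0r.
  by apply: eq_inner => x _; rewrite big_nil !mul0r.
rewrite big_cons -IH -innerDl//; last exact: L2_sum.
by apply: eq_inner => x _; rewrite big_cons.
Qed.

Lemma inner_ge0 f : 0 <= inner f f.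
Proof. by apply: Rintegral_ge0 => x _; rewrite -expr2 sqr_ge0. Qed.

Lemma inner_CauchySchwarz f g : L2 f -> L2 g -> inner f g ^+ 2 <= inner f f * inner g g.
Proof.
move=> Lf Lg; apply: discriminant_le; first exact: inner_ge0.
move=> s.
have := inner_ge0 (fun x => f x + s * g x).
have Ls : L2 (fun x => s * g x) by exact: L2Z.
rewrite innerDl ?innerDr ?innerZl ?innerZr//; try exact: L2D.
by rewrite (innerC g f); congr (0 <= _); ring.
Qed.

Lemma inner_eq0l f g : L2 f -> L2 g -> inner f f = 0 -> inner f g = 0.
Proof.
move=> Lf Lg f0; have := inner_CauchySchwarz Lf Lg.
by rewrite f0 mul0r => h; apply/eqP; rewrite -sqrf_eq0 eq_le h sqr_ge0.
Qed.

End SquareIntegrable.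

(** * Integration by parts for primitives of integrable functions *)

Section IntegrationByParts.
Variable R : realType.
Local Notation mu := (@lebesgue_measure R).
Implicit Types u v w : R -> R.

Definition primitive u x : R := \int[mu]_(y in `[0, x]) u y.

Lemma primitive0 u : primitive u 0 = 0.
Proof. by rewrite /primitive set_itv1 Rintegral_set1. Qed.

Section Segment.
Variable b : R.
Hypothesis b0 : 0 < b.
Local Notation E := (`[(0 : R)%R, b]%classic : set (measurableTypeR R)).
Local Notation int u := (mu.-integrable E (EFin \o u)).

Let mE : measurable E. Proof. exact: measurable_itv. Qed.

Lemma primitive_continuous u : int u -> {within E, continuous (primitive u)}.
Proof. by move=> iu; apply: parameterized_integral_continuous => //; exact: ltW. Qed.

Lemma primitive_measurable u : int u -> measurable_fun E (primitive u).
Proof.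
move=> iu; apply: subspace_continuous_measurable_fun => //; exact: primitive_continuous.
Qed.

Lemma primitive_le u x : int u -> E x -> `|primitive u x| <= \int[mu]_(y in E) `|u y|.
Proof.
move=> iu; rewrite /= in_itv/= => /andP[x0 xb].
have sub : `[0, x] `<=` E by apply: subset_itvl; rewrite bnd_simp.
have iux : mu.-integrable `[0, x] (EFin \o u) by exact: integrableS iu.
apply: (le_trans (le_normr_Rintegral _ iux)) => //.
have ian := integrable_norm iu.
apply: fine_le.
- by apply: integrable_fin_num; [exact: measurable_itv|exact: integrable_norm].
- exact: integrable_fin_num.
- apply: ge0_subset_integral => //=; apply: measurable_int; exact: ian.
Qed.

Lemma mul_primitive_integrable u v : int u -> int v ->
  int (fun x => u x * primitive v x).
Proof.
move=> iu iv; apply: (integrableMl mE iu (primitive_measurable iv)).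
exists (\int[mu]_(y in E) `|v y|); split; first exact: num_real.
by move=> y vy x /= Ex; apply: le_trans (ltW vy); exact: primitive_le.
Qed.

(** How far integration by parts is from holding for the primitives of [u] and
    [v] vanishing at 0. *)
Definition parts_defect u v : R := primitive u b * primitive v b -
  (\int[mu]_(x in E) (u x * primitive v x) + \int[mu]_(x in E) (v x * primitive u x)).

Lemma parts_defectC u v : parts_defect u v = parts_defect v u.
Proof.
have alg (p q d e : R) : p * q - (d + e) = q * p - (e + d) by ring.
exact: alg.
Qed.

Lemma primitive_bounded_mul_le u v : int u -> int v ->
  `|\int[mu]_(x in E) (u x * primitive v x)|
    <= (\int[mu]_(x in E) `|u x|) * \int[mu]_(x in E) `|v x|.
Proof.
move=> iu iv; have iuv := mul_primitive_integrable iu iv.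
apply: (le_trans (le_normr_Rintegral mE iuv)).
have inu := integrable_norm iu.
rewrite -RintegralZr//; apply: le_Rintegral => //.
- exact: integrable_norm iuv.
- exact: (integrableZr mE _ inu).
- by move=> x Ex; rewrite normrM ler_wpM2l//; exact: primitive_le.
Qed.

(** A primitive is bounded by the L1 norm of its integrand, so the defect is a
    bilinear form that is continuous for the L1 norm. *)
Lemma parts_defect_le u v : int u -> int v ->
  `|parts_defect u v|
    <= 3 * ((\int[mu]_(x in E) `|u x|) * \int[mu]_(x in E) `|v x|).
Proof.
move=> iu iv; set p := _ * \int[mu]_(x in E) _.
have h1 : `|\int[mu]_(x in E) (u x * primitive v x)| <= p.
  exact: primitive_bounded_mul_le.
have h2 : `|\int[mu]_(x in E) (v x * primitive u x)| <= p.
  by rewrite /p mulrC; exact: primitive_bounded_mul_le.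
have Eb : E b by rewrite /= in_itv/= lexx (ltW b0).
have h3 : `|primitive u b * primitive v b| <= p.
  by rewrite normrM ler_pM//; exact: primitive_le.
have alg (x y z q : R) : `|x| <= q -> `|y| <= q -> `|z| <= q ->
    `|x - (y + z)| <= 3 * q.
  by rewrite !ler_norml; lra.
exact: alg.
Qed.

Lemma parts_defectBr u v w : int u -> int v -> int w ->
  parts_defect u (fun x => v x - w x) = parts_defect u v - parts_defect u w.
Proof.
move=> iu iv iw.
have primitiveB x : E x ->
    primitive (fun y => v y - w y) x = primitive v x - primitive w x.
  rewrite /= in_itv/= => /andP[x0 xb].
  have sub : `[0, x] `<=` E by apply: subset_itvl; rewrite bnd_simp.
  by rewrite /primitive RintegralB//; [exact: integrableS iv|exact: integrableS iw].
have alg (a p q d e f g : R) : a * (p - q) - (d - e + (f - g)) =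
    a * p - (d + f) - (a * q - (e + g)) by ring.
rewrite /parts_defect primitiveB; last by rewrite /= in_itv/= lexx (ltW b0).
have -> : \int[mu]_(x in E) (u x * primitive (fun y => v y - w y) x) =
    \int[mu]_(x in E) (u x * primitive v x) - \int[mu]_(x in E) (u x * primitive w x).
  rewrite -RintegralB//; try exact: mul_primitive_integrable.
  by apply: eq_Rintegral => x; rewrite inE => Ex; rewrite primitiveB// mulrBr.
have -> : \int[mu]_(x in E) ((v x - w x) * primitive u x) =
    \int[mu]_(x in E) (v x * primitive u x) - \int[mu]_(x in E) (w x * primitive u x).
  rewrite -RintegralB//; try exact: mul_primitive_integrable.
  by apply: eq_Rintegral => x _; rewrite mulrBl.
exact: alg.
Qed.

Lemma continuous_int u : continuous u -> int u.
Proof.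
move=> cu; apply: continuous_compact_integrable; first exact: segment_compact.
exact: continuous_subspaceT.
Qed.

Lemma primitive_derivable u : continuous u ->
  derivable_oo_LRcontinuous (primitive u) 0 b /\
  {in `]0, b[, (primitive u)^`()%classic =1 u}.
Proof.
move=> cu; have iu := continuous_int cu.
have D x : x \in `]0, b[ ->
    derivable (primitive u) x 1 /\ (primitive u)^`()%classic x = u x.
  rewrite in_itv/= => /andP[x0 xb].
  by apply: (continuous_FTC1_closed xb iu) => //; exact: cu.
split; last by move=> x /D[].
have /(continuous_within_itvP _ b0)[_ r l] := primitive_continuous iu.
by split => // x /D[].
Qed.

Lemma parts_defect_continuous u v : continuous u -> continuous v ->
  parts_defect u v = 0.
Proof.
move=> cu cv; have [du u'] := primitive_derivable cu.
have [dv v'] := primitive_derivable cv.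
have := Rintegration_by_parts b0 (continuous_subspaceT cu) du u'
  (continuous_subspaceT cv) dv v'.
rewrite /parts_defect !primitive0 mulr0 subr0.
under eq_Rintegral do rewrite mulrC.
have alg (p d e : R) : d = p - e -> p - (e + d) = 0 by move=> ->; ring.
exact: alg.
Qed.

(** Continuous functions are dense in L1 and the defect is L1-continuous in its
    second argument. *)
Lemma parts_defect_density u : int u ->
  (forall v, continuous v -> parts_defect u v = 0) ->
  forall v, int v -> parts_defect u v = 0.
Proof.
move=> iu h v iv.
have muE : (mu E < +oo)%E.
  by rewrite lebesgue_measure_itv/= lte_fin b0 -EFinD ltry.
have [w [cw iw wv]] := approximation_continuous_integrable mE muE iv.
apply/eqP; rewrite -normr_le0; apply/ler_addgt0Pr => e e0; rewrite add0r.
set U := \int[mu]_(x in E) `|u x|.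
have U0 : 0 <= U by apply: Rintegral_ge0.
(* The added 1 keeps the denominator positive when u vanishes. *)
have d0 : 0 < e / (3 * U + 1) by rewrite divr_gt0//; lra.
have /fine_cvgP[fin /cvgrPdist_le /(_ _ d0)] := wv.
move=> near1; have [n hn] : exists n,
    `|0 - fine (\int[mu]_(z in E) `|(v z - w n z)%:E|)%E| <= e / (3 * U + 1).
  have [n _ Hn] := near1; exists n.
  exact: (Hn n (leqnn n)).
have iwn : int (fun x => v x - w n x) by exact: (integrableB mE iv (iw n)).
have -> : parts_defect u v = parts_defect u (fun x => v x - w n x).
  by rewrite parts_defectBr// (h (w n))// subr0.
apply: (le_trans (parts_defect_le iu iwn)); rewrite -/U.
move: hn; rewrite sub0r normrN => hn.
have : (\int[mu]_(x in E) `|v x - w n x|) <= e / (3 * U + 1).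
  exact: le_trans (ler_norm _) hn.
move: (\int[mu]_(x in E) _) => q; rewrite ler_pdivlMr; last by lra.
have := Rintegral_ge0.
nra.
Qed.

(** For two continuous integrands this is the classical formula; density is
    applied to one argument, then, by symmetry, to the other. *)
Lemma parts_defect_eq0 u v : int u -> int v -> parts_defect u v = 0.
Proof.
move=> iu; apply: parts_defect_density => // w cw.
rewrite parts_defectC; apply: parts_defect_density => //.
  exact: continuous_int.
by move=> w' cw'; exact: parts_defect_continuous.
Qed.

End Segment.
End IntegrationByParts.

(** * Functions in H1 of the unit interval *)

Section AbsolutelyContinuous.
Variable R : realType.
Local Notation mu := (@lebesgue_measure R).
Local Notation I01 := (`[(0 : R)%R, (1 : R)%R]%classic : set (measurableTypeR R)).
Implicit Types f g df dg : R -> R.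

(** A function of H1(0, 1), through its continuous representative [f], together
    with its weak derivative [df]. *)
Definition abscont f df : Prop := L2 df /\
  forall x, 0 <= x <= 1 -> f x = f 0 + primitive df x.

Lemma L2_integrable f : L2 f -> mu.-integrable I01 (EFin \o f).
Proof.
move=> Lf; have := L2_mul_integrable Lf (L2_cst 1).
by apply: eq_integrable => // x _ /=; rewrite mulr1.
Qed.

Lemma L2_integrable_sub f x : 0 <= x <= 1 -> L2 f ->
  mu.-integrable `[0, x] (EFin \o f).
Proof.
move=> /andP[x0 x1] Lf; apply: integrableS (L2_integrable Lf).
- exact: measurable_itv.
- exact: measurable_itv.
- by apply: subset_itvl; rewrite bnd_simp.
Qed.

Lemma abscont_measurable f df : abscont f df -> measurable_fun I01 f.
Proof.
move=> [Ld e]; have := primitive_measurable ltr01 (L2_integrable Ld).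
move=> /(measurable_funD (@measurable_cst _ _ _ _ I01 (f 0))).
apply: eq_measurable_fun => x; rewrite inE /= in_itv/= => x01.
by rewrite [RHS]e.
Qed.

Lemma abscont_bounded f df : abscont f df ->
  exists M, forall x, 0 <= x <= 1 -> `|f x| <= M.
Proof.
move=> [Ld e]; exists (`|f 0| + \int[mu]_(y in I01) `|df y|) => x x01.
rewrite e// (le_trans (ler_normD _ _))// lerD2l.
by apply: (primitive_le (L2_integrable Ld)); rewrite /= in_itv.
Qed.

Lemma abscont_mul_L2 f df g : abscont f df -> L2 g -> L2 (fun x => f x * g x).
Proof.
move=> Af Lg; have [M fM] := abscont_bounded Af.
exact: (bounded_mul_L2 (abscont_measurable Af) fM).
Qed.

Lemma abscont_L2 f df : abscont f df -> L2 f.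
Proof.
move=> Af; have [M fM] := abscont_bounded Af.
exact: (L2_bounded (abscont_measurable Af) fM).
Qed.

Lemma abscont_cst (a : R) : abscont (fun=> a) (fun=> 0).
Proof.
split; first exact: L2_cst.
by move=> x _; rewrite /primitive Rintegral_cst//= mul0r addr0.
Qed.

Lemma abscont_id : abscont id (fun=> 1).
Proof.
split; first exact: L2_cst.
move=> x /andP[x0 _]; rewrite /primitive Rintegral_cst//= add0r mul1r.
rewrite lebesgue_measure_itv/= lte_fin; case: ltP => /=; first by rewrite subr0.
by move=> x0'; apply/eqP; rewrite eq_le x0 x0'.
Qed.

Lemma abscontD f df g dg : abscont f df -> abscont g dg ->
  abscont (fun x => f x + g x) (fun x => df x + dg x).
Proof.
move=> [Lf ef] [Lg eg]; split; first exact: L2D.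
move=> x x01; rewrite ef// eg// /primitive RintegralD//; try exact: L2_integrable_sub.
have alg (p q d e : R) : p + q + (d + e) = p + d + (q + e) by ring.
exact: alg.
Qed.

(** Integration by parts on [0, x], up to the values at 0: with primitives [U]
    and [V] the product is (f 0 + U) (g 0 + V). *)
Lemma abscontM f df g dg : abscont f df -> abscont g dg ->
  abscont (fun x => f x * g x) (fun x => df x * g x + f x * dg x).
Proof.
move=> Af Ag; have [Lf ef] := Af; have [Lg eg] := Ag; split.
  apply: L2D; last exact: (abscont_mul_L2 Af).
  rewrite (_ : (fun x => _) = (fun x => g x * df x)); last first.
    by apply/funext => x; rewrite mulrC.
  exact: (abscont_mul_L2 Ag).
move=> x x01; case/andP : (x01); rewrite le_eqVlt => /predU1P[<-|x0] x1.
  by rewrite primitive0 addr0.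
have iu := L2_integrable_sub x01 Lf; have iv := L2_integrable_sub x01 Lg.
have iuv := mul_primitive_integrable x0 iu iv.
have ivu := mul_primitive_integrable x0 iv iu.
have mE : measurable (`[0, x] : set (measurableTypeR R)) by exact: measurable_itv.
have igu := integrableZl mE (g 0) iu; have ifv := integrableZl mE (f 0) iv.
have -> : primitive (fun y => df y * g y + f y * dg y) x =
    (g 0 * primitive df x + \int[mu]_(y in `[0, x]) (df y * primitive dg y)) +
    (f 0 * primitive dg x + \int[mu]_(y in `[0, x]) (dg y * primitive df y)).
  rewrite /primitive -!RintegralZl// -RintegralD// -RintegralD//.
  rewrite -[RHS]RintegralD//; first last.
  - exact: (integrableD mE ifv ivu).
  - exact: (integrableD mE igu iuv).
  apply: eq_Rintegral => y; rewrite inE /= in_itv/= => /andP[y0 yx].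
  rewrite [in LHS]ef ?y0 ?(le_trans yx)// [in LHS]eg ?y0 ?(le_trans yx)//.
  rewrite -/(primitive df y) -/(primitive dg y).
  move: (primitive _ _) (primitive _ _) => p q; ring.
have := parts_defect_eq0 x0 iu iv; rewrite /parts_defect ef// eg//.
move: (primitive _ _) (primitive _ _) (Rintegral _ _ _) (Rintegral _ _ _) => p q r s.
move=> h; have -> : r = p * q - s by lra.
ring.
Qed.

Lemma abscont_inner f df g dg : abscont f df -> abscont g dg ->
  inner df g + inner f dg = f 1 * g 1 - f 0 * g 0.
Proof.
move=> Af Ag; have [_ /(_ 1)] := abscontM Af Ag; rewrite ler01 lexx => -> //.
rewrite [RHS]addrC addKr /primitive /inner RintegralD//.
  by apply: L2_mul_integrable; [case: Af|exact: abscont_L2 Ag].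
by apply: L2_mul_integrable; [exact: abscont_L2 Af|case: Ag].
Qed.

Lemma abscont_continuous f df : continuous df ->
  (forall x : R, is_derive x 1 f (df x)) ->
  abscont f df.
Proof.
move=> cdf Df; split.
  have h := @continuous_compact_integrable R (fun x => df x ^+ 2) _
    (@segment_compact R 0 1).
  apply: sqr_integrable_L2.
    by apply: measurable_funTS; apply: continuous_measurable_fun.
  apply: h; apply: continuous_subspaceT => x.
  exact: (continuousM (cdf x) (cdf x)).
have cf : continuous f.
  by move=> x; apply: differentiable_continuous; apply/derivable1_diffP; case: (Df x).
move=> x /andP[]; rewrite le_eqVlt => /predU1P[<- _|x0 _].
  by rewrite primitive0 addr0.
have := @continuous_FTC2 R df f 0 x x0 (continuous_subspaceT cdf).
rewrite /primitive /Rintegral => ->.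
- by rewrite -EFinB/= addrC subrK.
- split.
  + by move=> y _; case: (Df y).
  + by apply: cvg_at_right_filter; exact: cf.
  + by apply: cvg_at_left_filter; exact: cf.
- by move=> y _; rewrite derive1E; exact: derive_val.
Qed.

Lemma is_derive_expRM (a x : R) :
  is_derive x 1 (fun x => expR (a * x)) (a * expR (a * x)).
Proof.
rewrite [X in is_derive _ _ _ X](_ : _ = expR (a * x) * a); last by rewrite mulrC.
apply: (@is_derive1_comp _ expR (fun x => a * x)).
have := @is_deriveZ _ _ _ id a x 1 1 (is_derive_id _ _).
by rewrite /GRing.scale /= mulr1.
Qed.

Lemma abscont_expR (a : R) :
  abscont (fun x => expR (a * x)) (fun x => a * expR (a * x)).
Proof.
apply: abscont_continuous; last exact: is_derive_expRM.
move=> x; apply: cvgM; first exact: cvg_cst.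
apply: continuous_comp; last exact: continuous_expR.
exact: mulrl_continuous.
Qed.

End AbsolutelyContinuous.

(** * Shifted Legendre polynomials *)

Section LegendrePolynomials.
Variable R : realType.
Implicit Types (p q : {poly R}) (j k m : nat).

Lemma natr_poly_neq0 k : (k.+1%:R : {poly R}) != 0.
Proof. by rewrite -polyC_natr polyC_eq0 pnatr_eq0. Qed.

(** Maps [0, 1] onto the interval [-1, 1] of the classical polynomials. *)
Definition affine_arg : {poly R} := 2 * 'X - 1.

(** Bonnet's recursion, carrying two consecutive polynomials. *)
Fixpoint legendre_pair k : {poly R} * {poly R} :=
  if k is j.+1 then
    let: (p, q) := legendre_pair j in
    (q, j.+2%:R^-1 *: ((2 * j + 3)%:R * (affine_arg * q) - j.+1%:R * p))
  else (1, affine_arg).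

Definition legendre k := (legendre_pair k).1.

Lemma legendre0 : legendre 0 = 1. Proof. by []. Qed.

Lemma legendre1 : legendre 1 = affine_arg. Proof. by []. Qed.

Lemma legendre_rec k : k.+2%:R * legendre k.+2 =
  (2 * k + 3)%:R * (affine_arg * legendre k.+1) - k.+1%:R * legendre k.
Proof.
rewrite /legendre /=; case: (legendre_pair k) => p q /=.
by rewrite mulr_natl -scaler_nat scalerA mulfV ?scale1r// pnatr_eq0.
Qed.

Lemma legendre_at1 k : (legendre k).[1] = 1.
Proof.
suff: (legendre k).[1] = 1 /\ (legendre k.+1).[1] = 1 by case.
elim: k => [|k [IH1 IH2]].
  by rewrite legendre0 legendre1 !hornerE; split => //; ring.
split=> //; have /(congr1 (horner^~ 1)) := legendre_rec k.
rewrite -!polyC_natr !hornerE IH1 IH2 /= => e.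
have k0 : k.+2%:R != 0 :> R by rewrite pnatr_eq0.
by apply: (mulfI k0); rewrite e; ring.
Qed.

Lemma legendre_at0 k : (legendre k).[0] = (-1) ^+ k.
Proof.
suff: (legendre k).[0] = (-1) ^+ k /\ (legendre k.+1).[0] = (-1) ^+ k.+1 by case.
elim: k => [|k [IH1 IH2]].
  by rewrite legendre0 legendre1 !hornerE; split => //; ring.
split=> //; have /(congr1 (horner^~ 0)) := legendre_rec k.
rewrite -!polyC_natr !hornerE IH1 IH2 /= => e.
have k0 : k.+2%:R != 0 :> R by rewrite pnatr_eq0.
by apply: (mulfI k0); rewrite e !exprS; ring.
Qed.

Lemma deriv_affine_arg : affine_arg^`() = 2.
Proof. by rewrite /affine_arg mulr_natl !poly.derivE subr0. Qed.

(** The two contiguity relations P'_(k+1) = y P'_k + (k + 1) P_k and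
    P'_k = y P'_(k+1) - (k + 1) P_(k+1), which feed each other through Bonnet's
    recursion; the factor 2 is the slope of the change of variable. *)
Lemma legendre_contiguous k :
  (legendre k.+1)^`() =
    affine_arg * (legendre k)^`() + (2 * k.+1)%:R * legendre k /\
  (legendre k)^`() =
    affine_arg * (legendre k.+1)^`() - (2 * k.+1)%:R * legendre k.+1.
Proof.
elim: k => [|k [A B]].
  rewrite legendre0 legendre1 deriv_affine_arg -[1]/(1%:P) derivC.
  by split; ring.
have rec := legendre_rec k.
have : (legendre k.+2)^`() =
    affine_arg * (legendre k.+1)^`() + (2 * k.+2)%:R * legendre k.+1.
  apply: (mulfI (natr_poly_neq0 k.+1)).
  have := congr1 (@deriv R) rec.
  rewrite derivB !derivM -!polyC_natr !derivC !polyC_natr deriv_affine_arg.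
  rewrite !mul0r !add0r B => ->; ring.
move: A B rec.
move: (legendre k) (legendre k)^`() (legendre k.+1) (legendre k.+1)^`()
  (legendre k.+2) (legendre k.+2)^`() affine_arg => p dp q dq r dr y.
move=> A B rec C; split=> //.
have -> : (2 * k.+2)%:R * r = 2 * (k.+2%:R * r) by ring.
rewrite rec C {1}A {1}B; ring.
Qed.

Lemma deriv_legendre_rec k : (legendre k.+2)^`() =
  (legendre k)^`() + (2 * (2 * k + 3))%:R * legendre k.+1.
Proof.
have [_ ->] := legendre_contiguous k; have [-> _] := legendre_contiguous k.+1.
ring.
Qed.

Lemma ell_rec k j : ell R k.+2 j =
  ell R k j + (if j == k.+1 then (2 * (2 * k + 3))%:R else 0).
Proof.
rewrite /ell; case: eqVneq => [->|jk].
  rewrite ltnn leqnSn add0r.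
  rewrite (_ : (k.+1 + k.+2)%N = (k.+1).*2.+1); last by lia.
  by rewrite exprS -mul2n exprM sqrrN !expr1n; ring.
rewrite addr0; case: (leqP j k) => jk1.
  rewrite (leq_trans jk1) ?leqW// (_ : (j + k.+2)%N = (j + k).+2); last by lia.
  by rewrite !exprS; ring.
case: leqP => // jk2; have -> : j = k.+2 by lia.
by rewrite addnn -mul2n exprM sqrrN !expr1n subrr mulr0.
Qed.

(** Telescoping of [deriv_legendre_rec] in steps of two: the indices [j] that
    appear are those below [k] of opposite parity, which is what the
    coefficients [ell] encode. *)
Lemma deriv_legendre k m : (k <= m)%N ->
  (legendre k)^`() = \sum_(j < m) ell R k j *: legendre j.
Proof.
suff H k' : ((k' <= m)%N -> (legendre k')^`() = \sum_(j < m) ell R k' j *: legendre j)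
  /\ ((k'.+1 <= m)%N -> (legendre k'.+1)^`() = \sum_(j < m) ell R k'.+1 j *: legendre j).
  by case: (H k).
elim: k' => [|i [IH1 IH2]].
  split=> [_|].
    rewrite legendre0 -[1]/(1%:P) derivC big1// => j _; rewrite /ell.
    case: leqP => [|_]; last by rewrite scale0r.
    rewrite leqn0 => /eqP ->.
    by rewrite subrr mulr0 scale0r.
  case: m => // m' _; rewrite legendre1 deriv_affine_arg big_ord_recl big1 => [|j _].
    rewrite legendre0 addr0 /ell /= (_ : _ * _ = 2); last by ring.
    by rewrite scaler_nat.
  have -> : ell R 1 (bump 0 j) = 0; last by rewrite scale0r.
  rewrite /ell /bump /= add1n; case: (nat_of_ord j) => [|j'] //=.
  by rewrite expr2 mulrNN mulr1 subrr mulr0.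
split=> // im; rewrite deriv_legendre_rec IH1; last by lia.
under [RHS]eq_bigr do rewrite ell_rec scalerDl.
rewrite big_split/=; congr (_ + _).
rewrite (bigD1 (Ordinal im))//= eqxx [X in _ = _ + X]big1 => [|j ji].
  by rewrite addr0 scaler_nat mulr_natl.
by rewrite -(inj_eq val_inj)/= in ji; rewrite (negPf ji) scale0r.
Qed.

End LegendrePolynomials.

Section LegendreOrthogonality.
Variable R : realType.
Implicit Types (f g : R -> R) (j k m N : nat).

Lemma abscont_horner (p : {poly R}) : abscont (horner p) (horner p^`()).
Proof.
elim/poly_ind: p => [|p c IH].
  rewrite deriv0 (_ : horner 0 = fun=> 0); first exact: abscont_cst.
  by apply/funext => x; rewrite horner0.
have := abscontD (abscontM IH (abscont_id R)) (abscont_cst c).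
congr (abscont _ _); apply/funext => x; first by rewrite !hornerE.
by rewrite derivD derivM derivX derivC !hornerE.
Qed.

Definition leg k : R -> R := horner (legendre R k).

Lemma abscont_leg k : abscont (leg k) (horner (legendre R k)^`()).
Proof. exact: abscont_horner. Qed.

Lemma L2_leg k : L2 (leg k).
Proof. exact: abscont_L2 (abscont_leg k). Qed.

Lemma leg_derivE k m x : (k <= m)%N ->
  (legendre R k)^`().[x] = \sum_(j < m) ell R k j * leg j x.
Proof.
move=> km; rewrite (deriv_legendre _ km) horner_sum.
by apply: eq_bigr => j _; rewrite hornerZ.
Qed.

Lemma inner_leg_deriv k m f : (k <= m)%N -> L2 f ->
  inner (horner (legendre R k)^`()) f = \sum_(j < m) ell R k j * inner (leg j) f.
Proof.
move=> km Lf.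
rewrite (_ : horner _ = fun x => \sum_(j < m) ell R k j * leg j x); last first.
  by apply/funext => x; exact: leg_derivE.
rewrite inner_suml//; last by move=> j; exact/L2Z/L2_leg.
by apply: eq_bigr => j _; rewrite innerZl//; exact: L2_leg.
Qed.

(** L_(m+2) - L_m vanishes at both endpoints and its derivative is
    2 (2 m + 3) L_(m+1): integrating L_j against that derivative leaves only
    pairings with the L_i, i < j, which is what drives the inductions proving
    orthogonality and computing the norms. *)
Lemma leg_parts j m : (2 * (2 * m + 3))%:R * inner (leg j) (leg m.+1) =
  \sum_(i < j) ell R j i * (inner (leg i) (leg m) - inner (leg i) (leg m.+2)).
Proof.
under eq_bigr do rewrite mulrBr.
rewrite sumrB.
have A := abscont_inner (abscont_leg j) (abscont_leg m.+2).
have B := abscont_inner (abscont_leg j) (abscont_leg m).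
have E : inner (leg j) (horner (legendre R m.+2)^`()) =
    inner (leg j) (horner (legendre R m)^`()) +
    (2 * (2 * m + 3))%:R * inner (leg j) (leg m.+1).
  rewrite -(innerZr _ (L2_leg m.+1) (L2_leg j)) -innerDr.
  - by apply: eq_inner => x _; rewrite deriv_legendre_rec -polyC_natr !hornerE.
  - by case: (abscont_leg m).
  - exact/L2Z/L2_leg.
  - exact: L2_leg.
move: A B; rewrite E /leg !legendre_at1 !legendre_at0 !exprS.
rewrite -/(leg j) -/(leg m) -/(leg m.+1) -/(leg m.+2).
rewrite !(@inner_leg_deriv j j)//; try exact: L2_leg.
move: (\sum_(i < j) _) (\sum_(i < j) _) (inner _ _) (inner _ _) => a b c d; lra.
Qed.

Lemma leg_orthogonal j k : (j < k)%N -> inner (leg j) (leg k) = 0.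
Proof.
elim/ltn_ind: j k => j IH [//|m]; rewrite ltnS => jm.
have c0 : (2 * (2 * m + 3))%:R != 0 :> R by rewrite pnatr_eq0; lia.
apply: (mulfI c0); rewrite mulr0 leg_parts big1// => i _.
by rewrite !IH ?subrr ?mulr0//; have := ltn_ord i; lia.
Qed.

Lemma leg_sqnorm k : (2 * k + 1)%:R * inner (leg k) (leg k) = 1.
Proof.
elim: k => [|m IH].
  have := abscont_inner (abscont_leg 0) (abscont_id R).
  rewrite /leg legendre0 -[1]/(1%:P) derivC !hornerC.
  rewrite (@eq_inner _ _ _ (fun=> 0 * 0) (fun=> 0)); last first.
    by move=> x _; rewrite hornerC !mul0r.
  rewrite innerZl; try exact: L2_cst.
  rewrite (@eq_inner _ _ (fun=> 1) (horner 1%:P) (horner 1%:P)); last first.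
    by move=> x _; rewrite !hornerC.
  by rewrite mul0r add0r => ->; ring.
have := leg_parts m.+1 m.
rewrite big_ord_recr/= [X in X + _]big1 => [|i _]; last first.
  by rewrite !leg_orthogonal ?subrr ?mulr0//; have := ltn_ord i; lia.
rewrite (@leg_orthogonal m m.+2)// subr0 add0r.
have -> : ell R m.+1 m = (2 * m + 1)%:R * 2.
  rewrite /ell leqnSn (addnS m m) exprS addnn -mul2n exprM sqrrN !expr1n; ring.
rewrite mulrAC IH mul1r; move: (inner _ _) => b e.
have : (2 * (2 * m + 3))%:R * b = 2 * ((2 * m.+1 + 1)%:R * b) by ring.
rewrite e; move: (_ * b) => d; lra.
Qed.

(** [f] minus its orthogonal projection on the first [N] Legendre polynomials. *)
Definition legendre_residual N f : R -> R := fun x =>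
  f x - \sum_(k < N) (2 * k + 1)%:R * inner f (leg k) * leg k x.

Lemma L2_residual N f : L2 f -> L2 (legendre_residual N f).
Proof.
by move=> Lf; apply: L2B => //; apply: L2_sum => k; exact/L2Z/L2_leg.
Qed.

Lemma residual_orthogonal N f (k : 'I_N) : L2 f ->
  inner (legendre_residual N f) (leg k) = 0.
Proof.
move=> Lf; have Lk := L2_leg k.
have LS j : L2 (fun x => (2 * j + 1)%:R * inner f (leg j) * leg j x).
  exact/L2Z/L2_leg.
rewrite innerBl//; last by apply: L2_sum => j; exact: LS.
rewrite inner_suml// (bigD1 k)//= innerZl; try exact: L2_leg.
rewrite mulrAC leg_sqnorm mul1r big1 ?addr0 ?subrr// => j jk.
rewrite innerZl; try exact: L2_leg.
have : val j != val k by [].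
rewrite neq_ltn => /orP[jk'|jk']; first by rewrite leg_orthogonal ?mulr0.
by rewrite (innerC (leg j)) leg_orthogonal ?mulr0.
Qed.

Lemma inner_residual N f g : L2 f -> L2 g ->
  inner (legendre_residual N f) (legendre_residual N g) =
  inner f g - \sum_(k < N) (2 * k + 1)%:R * (inner f (leg k) * inner g (leg k)).
Proof.
move=> Lf Lg; have Lr := L2_residual N Lf.
have LS h (j : 'I_N) : L2 (fun x => (2 * j + 1)%:R * inner h (leg j) * leg j x).
  exact/L2Z/L2_leg.
rewrite innerBr//; last by apply: L2_sum => j; exact: LS.
rewrite [X in _ - X](_ : _ = 0) ?subr0.
  rewrite innerBl//; last by apply: L2_sum => j; exact: LS.
  rewrite inner_suml//; congr (_ - _); apply: eq_bigr => j _.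
  by rewrite innerZl ?(innerC (leg j)) ?mulrA//; exact: L2_leg.
rewrite innerC inner_suml// big1// => k _.
by rewrite innerZl ?(innerC (leg k)) ?residual_orthogonal ?mulr0//; exact: L2_leg.
Qed.

End LegendreOrthogonality.

(** * Time derivatives and exponential decay *)

Section TimeDerivative.
Variable R : realType.
Local Notation time := [set t : R | 0 <= t].
Local Notation punctured t0 := (within time (dnbhs t0)).
Implicit Types (f g : R -> R) (t : R).

(** Difference quotients along times [t >= 0]: two-sided when [t0 > 0] and
    one-sided at [t0 = 0], as in [Hderivative]. *)
Definition tderiv f t0 (d : R) : Prop :=
  (t - t0)^-1 * (f t - f t0) @[t --> punctured t0] --> d.

Lemma near_punctured t0 : \forall t \near punctured t0, 0 <= t /\ t != t0.
Proof.
rewrite near_withinE; apply: filterS (nbhs_dnbhs_neq t0) => t tt0 t1.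
by split.
Qed.

Lemma cvg_punctured t0 : t - t0 @[t --> punctured t0] --> (0 : R).
Proof.
rewrite -[X in _ --> X](subrr t0); apply: cvgB; last exact: cvg_cst.
by do 2 apply: cvg_within_filter; exact: cvg_id.
Qed.

Lemma cvg_id_punctured f t0 (l : R) : f t @[t --> punctured t0] --> l ->
  f t0 = l -> f t @[t --> within time (nbhs t0)] --> l.
Proof.
move=> /cvgrPdist_lt fl f0; apply/cvgrPdist_lt => e e0.
have := fl e e0; rewrite !near_withinE.
apply: filterS => t ht t1; have [->|/ht/(_ t1)//] := eqVneq t t0.
by rewrite f0 subrr normr0.
Qed.

Lemma tderiv_cvg f t0 d : tderiv f t0 d -> f t @[t --> punctured t0] --> f t0.
Proof.
move=> fd.
have : f t0 + (t - t0) * ((t - t0)^-1 * (f t - f t0)) @[t --> punctured t0]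
    --> f t0 + 0 * d.
  by apply: cvgD; [exact: cvg_cst|apply: cvgM => //; exact: cvg_punctured].
rewrite mul0r addr0; apply: cvg_trans; apply: near_eq_cvg.
apply: filterS (near_punctured t0) => t [_ tt0].
by rewrite mulVKf ?subr_eq0// addrC subrK.
Qed.

Lemma tderiv_continuous f t0 d : tderiv f t0 d ->
  f t @[t --> within time (nbhs t0)] --> f t0.
Proof. by move=> /tderiv_cvg/cvg_id_punctured; apply. Qed.

Lemma tderivD f g t0 (d e : R) : tderiv f t0 d -> tderiv g t0 e ->
  tderiv (fun t => f t + g t) t0 (d + e).
Proof.
move=> fd ge; rewrite /tderiv; under eq_fun do rewrite opprD addrACA mulrDr.
exact: cvgD.
Qed.

Lemma tderiv_cst (a : R) t0 : tderiv (fun=> a) t0 0.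
Proof. by rewrite /tderiv; under eq_fun do rewrite subrr mulr0; exact: cvg_cst. Qed.

Lemma tderivM f g t0 (d e : R) : tderiv f t0 d -> tderiv g t0 e ->
  tderiv (fun t => f t * g t) t0 (d * g t0 + f t0 * e).
Proof.
move=> fd ge; rewrite /tderiv.
rewrite (_ : (fun t => _) = fun t => (t - t0)^-1 * (f t - f t0) * g t +
    f t0 * ((t - t0)^-1 * (g t - g t0))); last by apply/funext => t; ring.
apply: cvgD; first by apply: cvgM => //; exact: tderiv_cvg ge.
by apply: cvgM => //; exact: cvg_cst.
Qed.

Lemma tderivZ (a : R) f t0 d : tderiv f t0 d ->
  tderiv (fun t => a * f t) t0 (a * d).
Proof. by move=> /(tderivM (tderiv_cst a t0)); rewrite mul0r add0r. Qed.

Lemma tderiv_sum (I : Type) (s : seq I) (F : I -> R -> R) (D : I -> R) t0 :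
  (forall i, tderiv (F i) t0 (D i)) ->
  tderiv (fun t => \sum_(i <- s) F i t) t0 (\sum_(i <- s) D i).
Proof.
move=> FD; elim: s => [|i s IH].
  rewrite big_nil (_ : (fun t => _) = (fun=> 0)); first exact: tderiv_cst.
  by apply/funext => t; rewrite big_nil.
rewrite big_cons (_ : (fun t => _) = fun t => F i t + \sum_(i <- s) F i t).
  exact: tderivD.
by apply/funext => t; rewrite big_cons.
Qed.

Lemma tderiv_is_derive f t0 d : 0 < t0 -> tderiv f t0 d -> is_derive t0 1 f d.
Proof.
move=> t00 fd.
have h : h^-1 *: (f (h *: 1 + t0) - f t0) @[h --> (0 : R)^'] --> d.
  apply/cvgrPdist_lt => e e0; have /cvgrPdist_lt/(_ e e0) := fd.
  rewrite !near_withinE => /nbhs_ballP[r /= r0 B].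
  apply/nbhs_ballP; exists (Num.min r t0) => [|h]; first by rewrite /= lt_min r0.
  rewrite /ball /= sub0r normrN lt_min => /andP[hr ht] h0.
  have := B (h + t0); rewrite /ball /= opprD addrCA subrr addr0 normrN addrK.
  rewrite /GRing.scale /= mulr1; apply => //; first by rewrite -subr_eq0 addrK.
  by have := ler_norm (- h); rewrite normrN; lra.
by apply: DeriveDef; [apply/cvg_ex; exists d|exact/cvg_lim].
Qed.

(** Gronwall: V(t) e^(k t) has nonpositive derivative on positive times and is
    continuous up to time 0. *)
Lemma exponential_decay (V dV : R -> R) (k : R) :
  (forall t0, 0 <= t0 -> tderiv V t0 (dV t0)) ->
  (forall t0, 0 < t0 -> dV t0 + k * V t0 <= 0) ->
  forall t, 0 <= t -> V t <= V 0 * expR (- (k * t)).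
Proof.
move=> Vd dVle t t0.
pose W s := V s * expR (k * s).
have Wd (s : R) : 0 < s ->
    is_derive s (1 : R) W (V s * (k * expR (k * s)) + expR (k * s) * dV s).
  move=> s0; apply: is_deriveM.
    exact: tderiv_is_derive s0 (Vd s (ltW s0)).
  exact: is_derive_expRM.
suff : W t <= W 0.
  by rewrite /W mulr0 expR0 mulr1 expRN ler_pdivlMr ?expR_gt0.
apply: (@ler0_derive1_nincry R W 0) => //.
- by move=> s; rewrite in_itv/= andbT => /Wd[].
- move=> s; rewrite in_itv/= andbT => s0; have Ws := Wd s s0.
  rewrite derive1E derive_val.
  rewrite (_ : _ + _ = expR (k * s) * (dV s + k * V s)); last by ring.
  by rewrite pmulr_rle0 ?expR_gt0// dVle.
- apply/subspace_continuousP => s; rewrite /= in_itv/= andbT => s0.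
  rewrite (_ : (fun x => _) = time); last first.
    by apply/seteqP; split => x; rewrite /= in_itv/= andbT.
  apply: cvgM; first exact: tderiv_continuous (Vd s s0).
  apply: cvg_within_filter.
  have := @ex_derive _ _ _ _ _ _ _ (is_derive_expRM k s).
  by move=> /derivable1_diffP/differentiable_continuous.
Qed.

End TimeDerivative.

(** * Time derivatives of L2-valued curves *)

Section L2TimeDerivative.
Variable R : realType.
Local Notation mu := (@lebesgue_measure R).
Local Notation I01 := (`[(0 : R)%R, (1 : R)%R]%classic : set (measurableTypeR R)).
Local Notation time := [set t : R | 0 <= t].
Local Notation punctured t0 := (within time (dnbhs t0)).
Implicit Types (u v : R -> R -> R) (du dv : R -> R).

(** Turns the Cauchy-Schwarz bounds, which control squares, into limits. *)
Lemma sqr_cvg0 (T : Type) (F : set_system T) (FF : Filter F) (a b : T -> R) :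
  (\forall t \near F, a t ^+ 2 <= b t) -> b t @[t --> F] --> 0 ->
  a t @[t --> F] --> 0.
Proof.
move=> ab /cvgrPdist_lt b0; apply/cvgrPdist_lt => e e0.
have e20 : 0 < e ^+ 2 by rewrite exprn_gt0.
near=> t; rewrite sub0r normrN -(ltr_pXn2r (n := 2)) ?nnegrE ?(ltW e0)//.
rewrite real_normK ?num_real//; apply: (@le_lt_trans _ _ (b t)).
  by near: t.
apply: (le_lt_trans (ler_norm _)); rewrite -normrN -[- _]add0r.
by near: t; exact: b0.
Unshelve. all: by end_near. Qed.

Lemma inner_cvg0 (T : Type) (F : set_system T) (FF : Filter F)
    (D : T -> R -> R) (g : R -> R) :
  (\forall t \near F, L2 (D t)) -> L2 g ->
  inner (D t) (D t) @[t --> F] --> 0 -> inner (D t) g @[t --> F] --> 0.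
Proof.
move=> LD Lg D0; apply: (@sqr_cvg0 _ _ _ _ (fun t => inner (D t) (D t) * inner g g)).
  by apply: filterS LD => t LDt; exact: inner_CauchySchwarz.
by rewrite -(mul0r (inner g g)); apply: cvgM => //; exact: cvg_cst.
Qed.

Lemma inner_curves_cvg0 (T : Type) (F : set_system T) (FF : Filter F)
    (D E : T -> R -> R) :
  (\forall t \near F, L2 (D t) /\ L2 (E t)) ->
  inner (D t) (D t) @[t --> F] --> 0 -> inner (E t) (E t) @[t --> F] --> 0 ->
  inner (D t) (E t) @[t --> F] --> 0.
Proof.
move=> LD D0 E0.
apply: (@sqr_cvg0 _ _ _ _ (fun t => inner (D t) (D t) * inner (E t) (E t))).
  by apply: filterS LD => t [LDt LEt]; exact: inner_CauchySchwarz.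
by rewrite -(mul0r 0); exact: cvgM.
Qed.

(** The error made when the difference quotient of the curve [u] at [t0] is
    replaced by [du]. *)
Definition diff_defect u du t0 t : R -> R :=
  fun x => (t - t0)^-1 * (u t x - u t0 x) - du x.

(** Differentiability at [t0] of a curve with values in L2(0, 1). *)
Definition L2deriv u t0 du : Prop :=
  [/\ forall t, 0 <= t -> L2 (u t), L2 du &
    inner (diff_defect u du t0 t) (diff_defect u du t0 t)
      @[t --> punctured t0] --> 0].

Lemma L2_defect u t0 du t : 0 <= t0 -> 0 <= t -> L2deriv u t0 du ->
  L2 (diff_defect u du t0 t).
Proof.
by move=> t00 t1 [Lu Ldu _]; apply: L2B => //; apply: L2Z; apply: L2B; exact: Lu.
Qed.

Lemma L2deriv_cst (f : R -> R) t0 : L2 f -> L2deriv (fun=> f) t0 (fun=> 0).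
Proof.
move=> Lf; split => //; first exact: L2_cst.
rewrite (_ : (fun t => _) = fun=> 0); first exact: cvg_cst.
apply/funext => t; rewrite (@eq_inner _ _ _ (fun=> 0 * 0) (fun=> 0)).
  by rewrite innerZl ?mul0r//; exact: L2_cst.
by move=> x _; rewrite /diff_defect !(subrr, mulr0).
Qed.

(** Multiplication by a bounded function is a continuous operator of L2. *)
Lemma L2derivM u t0 du (w dw : R -> R) : abscont w dw -> L2deriv u t0 du ->
  0 <= t0 -> L2deriv (fun t x => w x * u t x) t0 (fun x => w x * du x).
Proof.
move=> Aw ud t00; have [Lu Ldu D0] := ud; split.
- by move=> t t1; apply: (abscont_mul_L2 Aw); exact: Lu.
- exact: (abscont_mul_L2 Aw).
have [M wM] := abscont_bounded Aw.
pose D := diff_defect u du t0.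
have Db : M ^+ 2 * inner (D t) (D t) @[t --> punctured t0] --> 0.
  by rewrite -[X in _ --> X](mulr0 (M ^+ 2)); apply: cvgM; [exact: cvg_cst|exact: D0].
apply: (squeeze_cvgr _ (cvg_cst 0) Db).
apply: filterS (near_punctured t0) => t [t1 tt0].
rewrite inner_ge0 /=; have LD := L2_defect t00 t1 ud.
have LwD := abscont_mul_L2 Aw LD.
rewrite -innerZl// (@eq_inner _ _ _ (fun x => w x * D t x) (fun x => w x * D t x)).
  apply: le_Rintegral; first exact: measurable_I01.
  - exact: L2_mul_integrable.
  - by apply: L2_mul_integrable => //; exact: L2Z.
  - move=> x; rewrite /= in_itv/= => x01; rewrite mulrACA -[leRHS]mulrA -!expr2.
    rewrite ler_wpM2r ?sqr_ge0// -real_normK ?num_real// ler_pXn2r ?nnegrE ?wM//.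
    by rewrite (le_trans _ (wM x x01)).
by move=> x _; rewrite /D /diff_defect; congr (_ * _); ring.
Qed.

(** Product rule for the L2 pairing. With D and E the errors of the difference
    quotients of [u] and [v], the quotient of the pairing is the announced
    derivative plus pairings that each contain D, E or the factor t - t0, and
    Cauchy-Schwarz sends them to 0. *)
Lemma inner_tderiv u v t0 du dv : 0 <= t0 -> L2deriv u t0 du -> L2deriv v t0 dv ->
  tderiv (fun t => inner (u t) (v t)) t0 (inner du (v t0) + inner (u t0) dv).
Proof.
move=> t00 ud vd; have [Lu Ldu D0] := ud; have [Lv Ldv E0] := vd.
pose D := diff_defect u du t0; pose E := diff_defect v dv t0.
have Lu0 := Lu t0 t00; have Lv0 := Lv t0 t00.
have LDE : \forall t \near punctured t0, L2 (D t) /\ L2 (E t).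
  by apply: filterS (near_punctured t0) => t [t1 _]; split; exact: L2_defect.
have LD : \forall t \near punctured t0, L2 (D t) by apply: filterS LDE => t [].
have LE : \forall t \near punctured t0, L2 (E t) by apply: filterS LDE => t [].
have main : (inner du (v t0) + inner (u t0) dv) +
    (inner (D t) (v t0) + inner (E t) (u t0)) +
    (t - t0) * (inner (D t) (E t) + inner (D t) dv + inner (E t) du + inner du dv)
    @[t --> punctured t0] --> inner du (v t0) + inner (u t0) dv + (0 + 0) +
      0 * (0 + 0 + 0 + inner du dv).
  apply: cvgD.
    by apply: cvgD; [exact: cvg_cst|apply: cvgD; exact: inner_cvg0].
  apply: cvgM; first exact: cvg_punctured.
  apply: cvgD; last exact: cvg_cst.
  apply: cvgD; last exact: inner_cvg0.
  by apply: cvgD; [exact: inner_curves_cvg0|exact: inner_cvg0].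
move: main; rewrite mul0r !addr0; apply: cvg_trans; apply: near_eq_cvg.
apply: filterS (near_punctured t0) => t [t1 tt0].
have LDt : L2 (D t) by exact: L2_defect.
have LEt : L2 (E t) by exact: L2_defect.
have h0 : t - t0 != 0 by rewrite subr_eq0.
have eu : u t = fun x => u t0 x + (t - t0) * (D t x + du x).
  by apply/funext => x; rewrite /D /diff_defect; field.
have ev : v t = fun x => v t0 x + (t - t0) * (E t x + dv x).
  by apply/funext => x; rewrite /E /diff_defect; field.
rewrite {}eu {}ev; move: (D t) (E t) LDt LEt => d e Ld Le.
have Ldd : L2 (fun x => d x + du x) by exact: L2D.
have Led : L2 (fun x => e x + dv x) by exact: L2D.
have Ldz : L2 (fun x => (t - t0) * (d x + du x)) by exact: L2Z.
have Lez : L2 (fun x => (t - t0) * (e x + dv x)) by exact: L2Z.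
rewrite innerDl//; last exact: L2D.
rewrite !innerDr// !innerZl// !innerZr// !innerDl// !innerDr//.
rewrite (innerC (u t0) e) (innerC du e).
move: (inner (u t0) (v t0)) (inner e (u t0)) (inner (u t0) dv) (inner d (v t0))
  (inner du (v t0)) (inner d e) (inner d dv) (inner e du) (inner du dv)
  => a1 a2 a3 a4 a5 a6 a7 a8 a9.
by move: (t - t0) h0 => h h0; field.
Qed.

End L2TimeDerivative.

(** * Quadratic forms and positive definite matrices *)

Section QuadraticForms.
Variable R : realType.
Implicit Types m n : nat.

Lemma col2P (a b : 'cV[R]_2) : a 0 0 = b 0 0 -> a 1 0 = b 1 0 -> a = b.
Proof.
move=> h0 h1; apply/matrixP => i j; rewrite ord1; case: i => -[|[|//]] i2.
  by rewrite (_ : Ordinal i2 = 0)//; exact: val_inj.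
by rewrite (_ : Ordinal i2 = 1)//; exact: val_inj.
Qed.

Lemma addmxE p q (A B : 'M[R]_(p, q)) i j : (A + B) i j = A i j + B i j.
Proof. by rewrite mxE. Qed.

Lemma oppmxE p q (A : 'M[R]_(p, q)) i j : (- A) i j = - A i j.
Proof. by rewrite mxE. Qed.

Lemma scalemxE p q (z : R) (A : 'M[R]_(p, q)) i j : (z *: A) i j = z * A i j.
Proof. by rewrite mxE. Qed.

Definition quadform m (Q : 'M[R]_m) (v : 'cV[R]_m) : R := (v^T *m Q *m v) 0 0.

Lemma bilinE m n (Q : 'M[R]_(m, n)) (u : 'cV[R]_m) (v : 'cV[R]_n) :
  (u^T *m Q *m v) 0 0 = \sum_i \sum_j Q i j * (u i 0 * v j 0).
Proof.
rewrite mxE exchange_big; apply: eq_bigr => j _; rewrite mxE mulr_suml.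
by apply: eq_bigr => i _; rewrite mxE mulrA (mulrC (Q i j)).
Qed.

Lemma quadformE m (Q : 'M[R]_m) v :
  quadform Q v = \sum_i \sum_j Q i j * (v i 0 * v j 0).
Proof. exact: bilinE. Qed.

Lemma trmx11 (A : 'M[R]_1) : A^T = A.
Proof. by apply/matrixP => i j; rewrite mxE !ord1. Qed.

Lemma bilinC m (Q : 'M[R]_m) (u v : 'cV[R]_m) : Q^T = Q ->
  (u^T *m Q *m v) 0 0 = (v^T *m Q *m u) 0 0.
Proof.
by move=> sQ; rewrite -[u^T *m Q *m v]trmx11 !trmx_mul trmxK sQ mulmxA.
Qed.

Lemma quadformD m (P Q : 'M[R]_m) v : quadform (P + Q) v = quadform P v + quadform Q v.
Proof. by rewrite /quadform mulmxDr mulmxDl mxE. Qed.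

Lemma quadformN m (Q : 'M[R]_m) v : quadform (- Q) v = - quadform Q v.
Proof. by rewrite /quadform mulmxN mulNmx mxE. Qed.

Lemma quadformZ m a (Q : 'M[R]_m) v : quadform (a *: Q) v = a * quadform Q v.
Proof. by rewrite /quadform -scalemxAr -scalemxAl mxE. Qed.

Lemma quadform_congr m n (Q : 'M[R]_m) (A : 'M[R]_(m, n)) v :
  quadform (A^T *m Q *m A) v = quadform Q (A *m v).
Proof. by rewrite /quadform trmx_mul !mulmxA. Qed.

Lemma quadform_He m n (P : 'M[R]_m) (A B : 'M[R]_(m, n)) v : P^T = P ->
  quadform (He (A^T *m P *m B)) v = 2 * ((A *m v)^T *m P *m (B *m v)) 0 0.
Proof.
move=> sP; rewrite /He quadformD.
have -> : quadform (A^T *m P *m B)^T v = quadform (A^T *m P *m B) v.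
  by rewrite /quadform -[v^T *m (A^T *m P *m B)^T *m v]trmx11 !trmx_mul !trmxK !mulmxA.
by rewrite -mulr2n mulr_natl /quadform trmx_mul !mulmxA.
Qed.

Lemma quadform_scalar m (a : R) (v : 'cV[R]_m) : quadform a%:M v = a * sqnorm v.
Proof.
rewrite /quadform mul_mx_scalar -scalemxAl mxE; congr (_ * _).
by rewrite mxE; apply: eq_bigr => i _; rewrite mxE expr2.
Qed.

Lemma sqnorm_ge0 m (v : 'cV[R]_m) : 0 <= sqnorm v.
Proof. by apply: sumr_ge0 => i _; exact: sqr_ge0. Qed.

Lemma sqr_le_sqnorm m (v : 'cV[R]_m) i : v i 0 ^+ 2 <= sqnorm v.
Proof.
rewrite /sqnorm (bigD1 i)//= lerDl; apply: sumr_ge0 => j _; exact: sqr_ge0.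
Qed.

Lemma quadform_le m (Q : 'M[R]_m) v :
  quadform Q v <= (\sum_i \sum_j `|Q i j|) * sqnorm v.
Proof.
rewrite quadformE mulr_suml; apply: ler_sum => i _.
rewrite mulr_suml; apply: ler_sum => j _.
apply: (le_trans (ler_norm _)); rewrite normrM ler_wpM2l// normrM.
have := sqr_le_sqnorm v i; have := sqr_le_sqnorm v j.
rewrite -(real_normK (num_real (v i 0))) -(real_normK (num_real (v j 0))).
have := normr_ge0 (v i 0); have := normr_ge0 (v j 0).
move: `|v i 0| `|v j 0| => a b; nra.
Qed.

Lemma posdef_ge0 m (Q : 'M[R]_m) v : posdef Q -> 0 <= quadform Q v.
Proof.
move=> [_ h]; have [->|/h/ltW//] := eqVneq v 0.
by rewrite /quadform mulmx0 mxE.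
Qed.

Lemma posdef_CauchySchwarz m (Q : 'M[R]_m) u v : posdef Q ->
  (u^T *m Q *m v) 0 0 ^+ 2 <= quadform Q u * quadform Q v.
Proof.
move=> pQ; apply: discriminant_le; first exact: posdef_ge0.
move=> s; have := posdef_ge0 (u + s *: v) pQ.
have -> : quadform Q (u + s *: v) =
    quadform Q u + 2 * s * (u^T *m Q *m v) 0 0 + s ^+ 2 * quadform Q v.
  rewrite {1}/quadform (_ : (u + s *: v)^T = u^T + s *: v^T); last first.
    by rewrite linearD linearZ.
  rewrite !mulmxDl !mulmxDr -!scalemxAl -!scalemxAr.
  have entry (a b c d : 'M[R]_1) : (a + s *: b + (s *: c + s *: (s *: d))) 0 0 =
      a 0 0 + s * b 0 0 + (s * c 0 0 + s * (s * d 0 0)) by rewrite !mxE.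
  rewrite entry -!/(quadform _ _).
  rewrite (bilinC v u pQ.1); ring.
by [].
Qed.

Lemma posdef_unitmx m (Q : 'M[R]_m) : posdef Q -> Q \in unitmx.
Proof.
move=> [_ pQ]; rewrite -row_free_unit -kermx_eq0; apply/rowV0P => v.
move=> /sub_kermxP vQ; apply/eqP; rewrite -[v]trmxK -[0]trmx0 (inj_eq trmx_inj).
by apply: contraT => /pQ; rewrite trmxK vQ mul0mx mxE ltxx.
Qed.

(** Elementary route avoiding eigenvalues: writing v_i = v^T Q (Q^-1 e_i),
    Cauchy-Schwarz for the form [Q] gives
    v_i^2 <= (v^T Q v) ((Q^-1 e_i)^T Q (Q^-1 e_i)), and these are summed over
    [i]. *)
Lemma posdef_coercive m (Q : 'M[R]_m) : posdef Q ->
  exists2 l : R, 0 < l & forall v, l * sqnorm v <= quadform Q v.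
Proof.
move=> pQ; have uQ := posdef_unitmx pQ; have [sQ _] := pQ.
pose e i : 'cV[R]_m := delta_mx i 0.
(* The added 1 keeps T positive in dimension 0. *)
pose T := 1 + \sum_i quadform Q (invmx Q *m e i).
have T0 : 0 < T by rewrite ltr_pwDl// sumr_ge0// => i _; exact: posdef_ge0.
exists T^-1; first by rewrite invr_gt0.
move=> v; rewrite mulrC ler_pdivrMr// mulrC mulrDl mul1r.
apply: (@le_trans _ _ ((\sum_i quadform Q (invmx Q *m e i)) * quadform Q v)).
  rewrite mulr_suml; apply: ler_sum => i _.
  rewrite mulrC; apply: le_trans (posdef_CauchySchwarz v (invmx Q *m e i) pQ).
  rewrite -mulmxA mulKVmx// mxE (bigD1 i)//= big1 => [|j ji].
    by rewrite !mxE !eqxx mulr1 addr0.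
  by rewrite !mxE (negPf ji) mulr0.
by rewrite lerDr posdef_ge0.
Qed.

End QuadraticForms.

(** * Weighted energies of vector-valued functions *)

Section Energies.
Variable R : realType.
Local Notation mu := (@lebesgue_measure R).
Local Notation I01 := (`[(0 : R)%R, (1 : R)%R]%classic : set (measurableTypeR R)).
Implicit Types (M dM : R -> 'M[R]_2) (f df : R -> 'cV[R]_2).

Definition entry f (i : 'I_2) : R -> R := fun x => f x i 0.

Lemma H1_abscont f df i : H1_deriv f df -> abscont (entry f i) (entry df i).
Proof. by move=> [Ldf e]; split; [exact: Ldf|move=> x x01; exact: e]. Qed.

Lemma H1_isL2 f df : H1_deriv f df -> isL2 f.
Proof. by move=> h i; exact: abscont_L2 (H1_abscont i h). Qed.

Lemma Rintegral_sum (I : Type) (s : seq I) (F : I -> R -> R) :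
  (forall i, mu.-integrable I01 (EFin \o F i)) ->
  \int[mu]_(x in I01) (\sum_(i <- s) F i x) = \sum_(i <- s) \int[mu]_(x in I01) F i x.
Proof.
move=> iF; elim: s => [|i s IH].
  rewrite big_nil; under eq_Rintegral do rewrite big_nil.
  by rewrite Rintegral_cst ?mul0r//; exact: measurable_I01.
rewrite big_cons -IH -RintegralD//.
- by apply: eq_Rintegral => x _; rewrite big_cons.
- have := integrable_sum (@measurable_I01 R) s (P := xpredT) (fun i _ => iF i).
  by apply: eq_integrable => // x _ /=; rewrite sumEFin.
Qed.

Lemma L2norm_sqr f : isL2 f -> L2norm f ^+ 2 = \sum_i inner (entry f i) (entry f i).
Proof.
move=> Lf; rewrite sqr_sqrtr; last by apply: Rintegral_ge0 => x _; exact: sqnorm_ge0.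
by rewrite Rintegral_sum => [|i]; [|exact: L2_sqr_integrable].
Qed.

Lemma Hnorm_sqr n (X : 'cV[R]_(n + 2)) f : isL2 f ->
  Hnorm X f ^+ 2 = sqnorm X + 2^-1 * \sum_i inner (entry f i) (entry f i).
Proof.
move=> Lf; rewrite sqr_sqrtr ?L2norm_sqr//.
by rewrite addr_ge0 ?sqnorm_ge0// mulr_ge0// sumr_ge0// => i _; exact: inner_ge0.
Qed.

(** The integral of f^T M f over [0, 1], kept as a sum of scalar pairings so that
    the calculus of pairings applies entrywise; [energy_ge0] goes back to the
    pointwise form. *)
Definition energy M f : R :=
  \sum_i \sum_j inner (fun x => M x i j * entry f i x) (entry f j).

(** Regular enough for the weighted functions to be in L2 and to be integrated
    by parts. *)
Definition smooth_weight M : Prop :=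
  forall i j, exists d, abscont (fun x => M x i j) d.

Lemma weight_L2 M f i j : smooth_weight M -> isL2 f ->
  L2 (fun x => M x i j * entry f i x).
Proof. by move=> /(_ i j)[d Md] Lf; exact: (abscont_mul_L2 Md (Lf i)). Qed.

Lemma energyB M1 M2 f : smooth_weight M1 -> smooth_weight M2 -> isL2 f ->
  energy (fun x => M1 x - M2 x) f = energy M1 f - energy M2 f.
Proof.
move=> s1 s2 Lf; rewrite /energy -sumrB; apply: eq_bigr => i _.
rewrite -sumrB; apply: eq_bigr => j _; 
rewrite -(innerBl (weight_L2 i j s1 Lf) (weight_L2 i j s2 Lf) (Lf j)).
by apply: eq_inner => x _; rewrite !mxE -!mulrBl.
Qed.

Lemma energyD M1 M2 f : smooth_weight M1 -> smooth_weight M2 -> isL2 f ->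
  energy (fun x => M1 x + M2 x) f = energy M1 f + energy M2 f.
Proof.
move=> s1 s2 Lf; rewrite -big_split; apply: eq_bigr => i _ /=.
rewrite -big_split; apply: eq_bigr => j _ /=.
rewrite -(innerDl (weight_L2 i j s1 Lf) (weight_L2 i j s2 Lf) (Lf j)).
by apply: eq_inner => x _; rewrite addmxE mulrDl.
Qed.

Lemma energyZ (a : R) M f : smooth_weight M -> isL2 f ->
  energy (fun x => a *: M x) f = a * energy M f.
Proof.
move=> sM Lf; rewrite mulr_sumr; apply: eq_bigr => i _ /=.
rewrite mulr_sumr; apply: eq_bigr => j _ /=.
rewrite -(innerZl _ (weight_L2 i j sM Lf) (Lf j)).
by apply: eq_inner => x _; rewrite scalemxE mulrA.
Qed.

Lemma smooth_weight_cst (Q : 'M[R]_2) : smooth_weight (fun=> Q).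
Proof. by move=> i j; exists (fun=> 0); exact: abscont_cst. Qed.

Lemma smooth_weightD M1 M2 : smooth_weight M1 -> smooth_weight M2 ->
  smooth_weight (fun x => M1 x + M2 x).
Proof.
move=> s1 s2 i j; have [d1 D1] := s1 i j; have [d2 D2] := s2 i j.
exists (fun x => d1 x + d2 x); have := abscontD D1 D2.
by congr (abscont _ _); apply/funext => x; rewrite mxE.
Qed.

Lemma smooth_weightM w dw M : abscont w dw -> smooth_weight M ->
  smooth_weight (fun x => w x *: M x).
Proof.
move=> Aw sM i j; have [d D] := sM i j.
exists (fun x => dw x * M x i j + w x * d x); have := abscontM Aw D.
by congr (abscont _ _); apply/funext => x; rewrite mxE.
Qed.

Lemma smooth_weightB M1 M2 : smooth_weight M1 -> smooth_weight M2 ->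
  smooth_weight (fun x => M1 x - M2 x).
Proof.
move=> s1 /(smooth_weightM (abscont_cst (-1)))/(smooth_weightD s1).
by congr smooth_weight; apply/funext => x; rewrite scaleN1r.
Qed.

Lemma energy_ge0 M f : smooth_weight M -> isL2 f ->
  (forall x v, 0 <= x <= 1 -> 0 <= quadform (M x) v) -> 0 <= energy M f.
Proof.
move=> sM Lf M0.
have iM i j : mu.-integrable I01 (EFin \o (fun x => M x i j * entry f i x * entry f j x)).
  by apply: L2_mul_integrable; [exact: weight_L2|exact: Lf].
have -> : energy M f = \int[mu]_(x in I01) quadform (M x) (f x).
  transitivity (\int[mu]_(x in I01)
      (\sum_i \sum_j M x i j * entry f i x * entry f j x)); last first.
    apply: eq_Rintegral => x _; rewrite quadformE.
    by apply: eq_bigr => i _; apply: eq_bigr => j _; rewrite mulrA.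
  rewrite Rintegral_sum => [|i].
    by apply: eq_bigr => i _; rewrite Rintegral_sum.
  have := integrable_sum (@measurable_I01 R) (index_enum _) (P := xpredT)
    (fun j _ => iM i j).
  by apply: eq_integrable => // x _ /=; rewrite sumEFin.
by apply: Rintegral_ge0 => x; rewrite /= in_itv/= => x01; exact: M0.
Qed.

Lemma energy_le M1 M2 f : smooth_weight M1 -> smooth_weight M2 -> isL2 f ->
  (forall x v, 0 <= x <= 1 -> quadform (M1 x) v <= quadform (M2 x) v) ->
  energy M1 f <= energy M2 f.
Proof.
move=> s1 s2 Lf h; rewrite -subr_ge0 -energyB//; apply: energy_ge0 => //.
  exact: smooth_weightB.
by move=> x v x01; rewrite quadformD quadformN subr_ge0 h.
Qed.

Lemma energy_cst (Q : 'M[R]_2) f : isL2 f ->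
  energy (fun=> Q) f = \sum_i \sum_j Q i j * inner (entry f i) (entry f j).
Proof.
move=> Lf; apply: eq_bigr => i _; apply: eq_bigr => j _.
by rewrite innerZl//; exact: Lf.
Qed.

Lemma energy_scalar (a : R) f : isL2 f ->
  energy (fun=> a%:M) f = a * \sum_i inner (entry f i) (entry f i).
Proof.
move=> Lf; rewrite energy_cst// mulr_sumr; apply: eq_bigr => i _.
rewrite (bigD1 i)//= mxE eqxx mulr1n big1 ?addr0// => j ji.
by rewrite mxE eq_sym (negPf ji) mulr0n mul0r.
Qed.

Definition legendre_coef f (k : nat) : 'cV[R]_2 := \col_i inner (entry f i) (leg k).

(** The energy of the residual of [f] is nonnegative, and by orthogonality it is
    the difference of the two sides. *)
Lemma energy_bessel (Q : 'M[R]_2) f N : isL2 f -> (forall v, 0 <= quadform Q v) ->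
  \sum_(k < N) (2 * k + 1)%:R * quadform Q (legendre_coef f k) <= energy (fun=> Q) f.
Proof.
move=> Lf Q0.
pose r x : 'cV[R]_2 := \col_i legendre_residual N (entry f i) x.
have er i : entry r i = legendre_residual N (entry f i).
  by apply/funext => x; rewrite /entry mxE.
have Lr : isL2 r by move=> i; have := L2_residual N (Lf i); rewrite -er.
have := @energy_ge0 (fun=> Q) r (@smooth_weight_cst Q) Lr (fun _ v _ => Q0 v).
rewrite -[in X in _ -> X]subr_ge0 !energy_cst//; congr (0 <= _).
have e i j : inner (entry r i) (entry r j) = inner (entry f i) (entry f j) -
    \sum_(k < N) (2 * k + 1)%:R * (inner (entry f i) (leg k) * inner (entry f j) (leg k)).
  by rewrite !er inner_residual//; exact: Lf.
under eq_bigr do under eq_bigr do rewrite e mulrBr.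
rewrite (_ : \sum_(k < N) _ = \sum_i \sum_j
    Q i j * \sum_(k < N) (2 * k + 1)%:R *
      (inner (entry f i) (leg k) * inner (entry f j) (leg k))).
  by rewrite -sumrB; apply: eq_bigr => i _; rewrite -sumrB.
under eq_bigr do rewrite quadformE mulr_sumr.
rewrite exchange_big; apply: eq_bigr => i _ /=.
under eq_bigr do rewrite mulr_sumr.
rewrite exchange_big; apply: eq_bigr => j _ /=.
rewrite mulr_sumr; apply: eq_bigr => k _; rewrite !mxE mulrCA; congr (_ * _).
Qed.

(** Entrywise integration over [0, 1] of
    (f^T M f)' = f'^T M f + f^T M f' + f^T M' f. *)
Lemma energy_parts M dM f df :
  (forall i j, abscont (fun x => M x i j) (fun x => dM x i j)) -> H1_deriv f df ->
  \sum_i \sum_j (inner (fun x => M x i j * entry df i x) (entry f j) +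
                 inner (fun x => M x i j * entry f i x) (entry df j)) =
  quadform (M 1) (f 1) - quadform (M 0) (f 0) - energy dM f.
Proof.
move=> AM Hf; rewrite !quadformE -!sumrB; apply: eq_bigr => i _.
rewrite -!sumrB; apply: eq_bigr => j _.
have Ai := H1_abscont i Hf; have Aj := H1_abscont j Hf.
have := abscont_inner (abscontM (AM i j) Ai) Aj.
rewrite innerDl; last 3 first.
- rewrite (_ : (fun x => _) = fun x => entry f i x * dM x i j).
    by apply: (abscont_mul_L2 Ai); case: (AM i j).
  by apply/funext => x; rewrite mulrC.
- by apply: (abscont_mul_L2 (AM i j)); case: Ai.
- exact: abscont_L2 Aj.
rewrite /entry -!mulrA; move: (inner _ _) (inner _ _) (inner _ _) => a b c; lra.
Qed.

Lemma energy_tderiv M (chi : R -> R -> 'cV[R]_2) (dchi : R -> 'cV[R]_2) t0 :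
  smooth_weight M -> 0 <= t0 ->
  (forall i, L2deriv (fun t => entry (chi t) i) t0 (entry dchi i)) ->
  tderiv (fun t => energy M (chi t)) t0
    (\sum_i \sum_j (inner (fun x => M x i j * entry dchi i x) (entry (chi t0) j) +
                    inner (fun x => M x i j * entry (chi t0) i x) (entry dchi j))).
Proof.
move=> sM t00 dc; apply: tderiv_sum => i; apply: tderiv_sum => j.
have [d Ad] := sM i j.
exact: (inner_tderiv t00 (L2derivM Ad (dc _) t00) (dc _)).
Qed.

End Energies.

(** * Boundary traces and the matrix inequality *)

Section BoundaryAlgebra.
Variables (R : realType) (n : nat) (c g k e1 : R).
Variables (Bc2 : 'M[R]_(n, 2)) (C1 : 'rV[R]_(n + 2)) (At : 'M[R]_(n + 2)) (N : nat).
Implicit Types (X : 'cV[R]_(n + 2)) (Xi : 'cV[R]_(dimproj N)) (w a b : 'cV[R]_2).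

Let augmented X Xi w : 'cV[R]_(dimxi n N) := col_mx (col_mx X Xi) w.

(** Parametrizes the traces allowed by the boundary condition: given the traces
    [a] at 0 and [b] at 1, the free coordinates are the half-sums of
    a_1, b_0 and of a_0, b_1. *)
Definition midpoint a b : 'cV[R]_2 :=
  \col_(i < 2) (if i == 0 then (a 1 0 + b 0 0) / 2 else (a 0 0 + b 1 0) / 2).

Lemma mx_rows2E (r : seq (seq R)) w (i : 'I_2) : (mx_rows 2 2 r *m w) i 0 =
  nth 0 (nth [::] r i) 0 * w 0 0 + nth 0 (nth [::] r i) 1 * w 1 0.
Proof.
rewrite mxE big_ord_recl big_ord1 !mxE.
by rewrite (_ : lift ord0 ord0 = 1)//; exact: val_inj.
Qed.

Lemma col_mx11E (u v : 'M[R]_1) : col_mx u v 0 0 = u 0 0 /\ col_mx u v 1 0 = v 0 0.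
Proof.
split; first by rewrite -(col_mxEu u v); congr (col_mx _ _ _ _); exact: val_inj.
by rewrite -(col_mxEd u v); congr (col_mx _ _ _ _); exact: val_inj.
Qed.

Lemma boundaryE X f : boundary c g k C1 X f ->
  (1 - c * g) * f 0 0 0 = (1 + c * g) * f 1 1 0 - 2 * c * g * (C1 *m X) 0 0 /\
  (1 - c * k) * f 0 1 0 = (1 + c * k) * f 1 0 0.
Proof.
have [d0 d1] := col_mx11E ((2 * c * g) *: (C1 *m X)) 0.
move=> /matrixP bd; have := bd 0 0; have := bd 1 0.
rewrite (addmxE _ _ 1) (addmxE _ _ 0) !oppmxE !mx_rows2E d0 d1 scalemxE /=.
have -> : (0 : 'M[R]_1) 0 0 = 0 by rewrite mxE.
by rewrite !mul0r !add0r !addr0 subr0.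
Qed.

Lemma G_augmented X Xi w : G_ c g k C1 N *m augmented X Xi w =
  col_mx (- (c * g) *: (C1 *m X)) 0 + mxG c g k *m w.
Proof.
rewrite /G_ /augmented mul_row_col; congr (_ + _).
rewrite mul_row_col mul0mx addr0 (mul_col_mx (- (c * g) *: C1) 0 X).
by rewrite mul0mx scalemxAl.
Qed.

Lemma H_augmented X Xi w : H_ c g k C1 N *m augmented X Xi w =
  col_mx (0 : 'M[R]_1) ((c * g) *: (C1 *m X)) + mxH c g k *m w.
Proof.
rewrite /H_ /augmented mul_row_col; congr (_ + _).
rewrite mul_row_col mul0mx addr0 (mul_col_mx (0 : 'rV[R]_(n + 2)) ((c * g) *: C1) X).
by rewrite mul0mx scalemxAl.
Qed.

Lemma midpointE a b : midpoint a b 0 0 = (a 1 0 + b 0 0) / 2 /\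
  midpoint a b 1 0 = (a 0 0 + b 1 0) / 2.
Proof. by rewrite !mxE. Qed.

(** Each scalar boundary equation, added to the definition of the half-sum of
    the two traces that it relates, recovers either trace. *)
Lemma boundary_G X Xi f : boundary c g k C1 X f ->
  G_ c g k C1 N *m augmented X Xi (midpoint (f 0) (f 1)) = f 0.
Proof.
move=> /boundaryE[b0 b1]; rewrite G_augmented.
have [m0 m1] := midpointE (f 0) (f 1).
have [c0 c1] := col_mx11E (- (c * g) *: (C1 *m X)) 0.
have z : (0 : 'M[R]_1) 0 0 = 0 by rewrite mxE.
apply: col2P; rewrite addmxE mx_rows2E m0 m1 ?c0 ?c1 ?scalemxE /=.
  move: b0; move: (C1 *m X) (f 0) (f 1) => s u v; move: (s 0 0) => s'.
  lra.
rewrite z; move: b1; move: (f 0) (f 1) => u v; lra.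
Qed.

Lemma boundary_H X Xi f : boundary c g k C1 X f ->
  H_ c g k C1 N *m augmented X Xi (midpoint (f 0) (f 1)) = f 1.
Proof.
move=> /boundaryE[b0 b1]; rewrite H_augmented.
have [m0 m1] := midpointE (f 0) (f 1).
have [c0 c1] := col_mx11E 0 ((c * g) *: (C1 *m X)).
have z : (0 : 'M[R]_1) 0 0 = 0 by rewrite mxE.
apply: col2P; rewrite addmxE mx_rows2E m0 m1 ?c0 ?c1 ?scalemxE /=.
  rewrite z; move: b1; move: (f 0) (f 1) => u v; lra.
move: b0; move: (C1 *m X) (f 0) (f 1) => s u v; move: (s 0 0) => s'.
lra.
Qed.

(** The input matrix only reads the two sums a_0 + b_1 and a_1 + b_0, in which the
    contributions of C1 X to the traces cancel. *)
Lemma tildeB_midpoint a b :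
  tildeB e1 Bc2 *m col_mx (mxG c g k) (mxH c g k) *m midpoint a b =
  tildeB e1 Bc2 *m col_mx a b.
Proof.
rewrite -mulmxA mul_col_mx /tildeB -!scalemxAl -!mulmxA; congr (_ *: (_ *m _)).
have sel (u v : 'cV[R]_2) (i : 'I_2) :
    (mx_rows 2 (2 + 2) [:: [:: 1; 0; 0; 1]; [:: 0; 1; 1; 0]] *m col_mx u v) i 0 =
    if i == 0 then u 0 0 + v 1 0 else u 1 0 + v 0 0.
  rewrite mxE big_split_ord /= !big_ord_recl !big_ord0 !col_mxEu !col_mxEd !mxE /=.
  have -> : lift ord0 ord0 = 1 :> 'I_2 by exact: val_inj.
  case: i => -[|[|//]] i2 /=; ring.
have [m0 m1] := midpointE a b.
by apply: col2P; rewrite !sel /= !mx_rows2E m0 m1 /=; field.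
Qed.

Lemma Z_augmented X Xi a b : let xi := augmented X Xi (midpoint a b) in
  G_ c g k C1 N *m xi = a -> H_ c g k C1 N *m xi = b ->
  Z_ c g k C1 At (tildeB e1 Bc2) N *m xi =
  col_mx (At *m X + tildeB e1 Bc2 *m col_mx a b)
         (c *: (ones_ R N *m b - altones_ R N *m a - L_ R N *m Xi)).
Proof.
move=> xi Ga Hb; rewrite /Z_ mul_col_mx; congr col_mx.
  rewrite /xi /augmented mul_row_col mul_row_col mul0mx addr0.
  by rewrite tildeB_midpoint.
rewrite !mulmxBl -!scalemxAl -!mulmxA Ga Hb -!scalerBr; congr (_ *: (_ - _)).
by rewrite /xi /augmented mul_row_col mul_row_col !mul0mx add0r addr0.
Qed.

Lemma F_augmented X Xi w : F_ R n N *m augmented X Xi w = col_mx X Xi.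
Proof. by rewrite /F_ /augmented mul_row_col mul1mx mul0mx addr0. Qed.

Lemma quadform_R (Rm : 'M[R]_2) X (B : 'I_N.+1 -> 'cV[R]_2) w :
  quadform (R_ n N Rm) (augmented X (\mxcol_k B k) w) =
  \sum_(k < N.+1) (2 * k + 1)%:R * quadform Rm (B k).
Proof.
rewrite /quadform /R_ /augmented -mulmxA mul_block_col !mul0mx !addr0.
rewrite mul_block_col !mul0mx !add0r mul_mxdiag_mxcol !tr_col_mx.
rewrite mul_row_col mul_row_col !mulmx0 !addr0 add0r tr_mxcol mul_mxrow_mxcol summxE.
apply: eq_bigr => i _.
by rewrite -scalemxAl -scalemxAr scalemxE mulmxA.
Qed.

(** The matrix inequality evaluated at [xi], with each block of Psi rewritten as
    a form in the image of [xi]. *)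
Lemma LMI_decay alpha (P : 'M[R]_(n + 2 + dimproj N)) (Rm Sm : 'M[R]_2) xi :
  let Z := Z_ c g k C1 At (tildeB e1 Bc2) N in
  let F := F_ R n N in
  P^T = P ->
  negdef (Psi_ c g k C1 At (tildeB e1 Bc2) alpha P Rm Sm - c *: R_ n N Rm) ->
  2 * ((Z *m xi + alpha *: (F *m xi))^T *m P *m (F *m xi)) 0 0
  - c * quadform Sm (G_ c g k C1 N *m xi)
  + c * expR (2 * alpha / c) * quadform (Sm + Rm) (H_ c g k C1 N *m xi)
  - c * quadform (R_ n N Rm) xi <= 0.
Proof.
move=> Z F sP /posdef_ge0 => /(_ xi).
rewrite quadformN oppr_ge0 /Psi_ 3!quadformD !quadformN !quadformZ.
rewrite !quadform_congr quadform_He// -/Z -/F mulmxDl.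
by rewrite -scalemxAl.
Qed.

End BoundaryAlgebra.

(** * Components of a trajectory *)

Section Trajectories.
Variables (R : realType) (n N : nat).
Local Notation mu := (@lebesgue_measure R).
Local Notation time := [set t : R | 0 <= t].
Local Notation punctured t0 := (within time (dnbhs t0)).
Implicit Types (X dX : R -> 'cV[R]_(n + 2)) (chi chit : R -> R -> 'cV[R]_2).
Implicit Types (f df : R -> 'cV[R]_2).

(** The moments of [f] against the Legendre polynomials of degree at most [N],
    stacked in the block order of [ones_] and [L_]. *)
Definition Xi f : 'cV[R]_(dimproj N) := \mxcol_(k < N.+1) legendre_coef f k.

(** Each component of the error is dominated by its norm in the state space. *)
Lemma Hderivative_components X dX chi chit t0 : 0 <= t0 ->
  (forall t, 0 <= t -> isL2 (chi t)) -> (forall t, 0 <= t -> isL2 (chit t)) ->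
  Hderivative X dX chi chit ->
  (forall i, tderiv (fun t => X t i 0) t0 (dX t0 i 0)) /\
  (forall i, L2deriv (fun t => entry (chi t) i) t0 (entry (chit t0) i)).
Proof.
move=> t00 Lc Lt Hd.
pose EX t := (t - t0)^-1 *: (X t - X t0) - dX t0.
pose Ec t : R -> 'cV[R]_2 := fun x => (t - t0)^-1 *: (chi t x - chi t0 x) - chit t0 x.
have eE t i : entry (Ec t) i =
    diff_defect (fun t => entry (chi t) i) (entry (chit t0) i) t0 t.
  by apply/funext => x; rewrite /entry /Ec !mxE.
have LE t : 0 <= t -> isL2 (Ec t).
  move=> t1 i; change (L2 (entry (Ec t) i)); rewrite eE.
  apply: L2B; last exact: Lt.
  by apply: L2Z; apply: L2B; exact: Lc.
have Q0 : Hnorm (EX t) (Ec t) ^+ 2 @[t --> punctured t0] --> 0.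
  by rewrite -[X in _ --> X](mulr0 0); have H := Hd t0 t00; exact: cvgM.
split=> i.
- rewrite /tderiv; apply/subr_cvg0; apply: (@sqr_cvg0 _ _ _ _ _ _ _ Q0).
  apply: filterS (near_punctured t0) => t [t1 _].
  rewrite Hnorm_sqr; last exact: LE.
  have -> : (t - t0)^-1 * (X t i 0 - X t0 i 0) - dX t0 i 0 = EX t i 0.
    by rewrite /EX !mxE.
  apply: (le_trans (sqr_le_sqnorm _ i)); rewrite lerDl mulr_ge0//.
  by apply: sumr_ge0 => j _; exact: inner_ge0.
- split; [by move=> t t1; exact: Lc|exact: Lt|].
  have Q1 : 2 * Hnorm (EX t) (Ec t) ^+ 2 @[t --> punctured t0] --> 0.
    by rewrite -[X in _ --> X](mulr0 2); apply: cvgM => //; exact: cvg_cst.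
  apply: (squeeze_cvgr _ (cvg_cst 0) Q1).
  apply: filterS (near_punctured t0) => t [t1 _].
  rewrite inner_ge0 -eE Hnorm_sqr; last exact: LE.
  rewrite (bigD1 i)//=.
  have := sqnorm_ge0 (EX t).
  have : 0 <= \sum_(j < 2 | j != i) inner (entry (Ec t) j) (entry (Ec t) j).
    by apply: sumr_ge0 => j _; exact: inner_ge0.
  move: (\sum_(j < 2 | j != i) _) (inner _ _) (sqnorm _) => a b d; lra.
Qed.

(** Component [i] of f - c df has zero L2 norm: the almost everywhere
    equality on the open interval is enough, the endpoints being negligible. *)
Lemma ae_inner (c : R) f df g (i : 'I_2) : isL2 f -> isL2 df -> L2 g ->
  {ae mu, forall x, x \in `]0, 1[ -> f x = c *: df x} ->
  inner (entry f i) g = c * inner (entry df i) g.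
Proof.
move=> Lf Ldf Lg fdf.
have Lz : L2 (fun x => c * entry df i x) by apply: L2Z; exact: Ldf.
have Ld : L2 (fun x => entry f i x - c * entry df i x) by apply: L2B => //; exact: Lf.
suff : inner (fun x => entry f i x - c * entry df i x) g = 0.
  rewrite innerBl//; last exact: Lf.
  by rewrite innerZl//; [move/eqP; rewrite subr_eq0 => /eqP|exact: Ldf].
apply: inner_eq0l => //; set d := fun x => _.
have id2 : mu.-integrable `[0, 1] (EFin \o (fun x => d x * d x)).
  exact: L2_mul_integrable.
rewrite /inner -Rintegral_itv_bndo_bndc; last first.
  by apply: integrableS id2 => //; exact: subset_itv_co_cc.
rewrite -Rintegral_itv_obnd_cbnd; last first.
  by apply: integrableS id2 => //; exact: subset_itv_oo_cc.
rewrite /Rintegral (ae_eq_integral (cst 0%E))//.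
- by rewrite integral0.
- by apply: (measurable_int mu); apply: integrableS id2 => //; exact: subset_itv_oo_cc.
case: fdf => A [mA A0 sub]; exists A; split => // x nx; apply: sub => fx.
apply: nx => x01; rewrite /= /d /entry fx ?mxE ?subrr ?mulr0//.
Qed.

Lemma Xi_entry f i : Xi f i 0 = inner (entry f (tagnat.sig2 i)) (leg (tagnat.sig1 i)).
Proof. by rewrite !mxE. Qed.

Lemma Xi_tderiv chi df t0 :
  (forall i, L2deriv (fun t => entry (chi t) i) t0 (entry df i)) -> 0 <= t0 ->
  forall i, tderiv (fun t => Xi (chi t) i 0) t0 (Xi df i 0).
Proof.
move=> dc t00 i; under eq_fun do rewrite Xi_entry; rewrite Xi_entry.
have := inner_tderiv t00 (dc (tagnat.sig2 i))
  (L2deriv_cst t0 (L2_leg R (tagnat.sig1 i))).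
rewrite [X in _ + X](_ : _ = 0) ?addr0//.
rewrite (@eq_inner _ _ _ (fun=> 0) (fun=> 0 * 0)) => [|x _]; last by rewrite !mulr0.
by rewrite innerZr ?mul0r//; exact: L2_cst.
Qed.

(** Block [k] is integration by parts against L_k: the traces are multiplied by
    L_k(1) = 1 and L_k(0) = (-1)^k, and L_k' is expanded on lower degrees. *)
Lemma Xi_space_derivative f df : H1_deriv f df ->
  Xi df = ones_ R N *m f 1 - altones_ R N *m f 0 - L_ R N *m Xi f.
Proof.
move=> Hf; rewrite /ones_ /altones_ /L_ /Xi !mxcol_mul mul_mxblock_mxrow -!mxcolB.
apply: eq_mxcol => k; apply/matrixP => i j; rewrite ord1.
rewrite mul1mx mul_scalar_mx !addmxE !oppmxE scalemxE mxE.
have := abscont_inner (abscont_leg R k) (H1_abscont i Hf).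
rewrite (inner_leg_deriv (m := N.+1)); [|exact: ltnW|exact: abscont_L2 (H1_abscont i Hf)].
rewrite /leg legendre_at1 legendre_at0 -/(leg k) mul1r innerC => e.
rewrite summxE (eq_bigr (fun j : 'I_N.+1 => ell R k j * inner (leg j) (entry f i))).
  by move: e; rewrite /entry; move: (inner _ _) (\sum_j _) => a b; lra.
by move=> l _; rewrite mul_scalar_mx scalemxE mxE innerC.
Qed.

End Trajectories.

(** * The Lyapunov functional *)

Section Lyapunov.
Variables (R : realType) (n N : nat).
Implicit Types (X : 'cV[R]_(n + 2)) (f df : R -> 'cV[R]_2).

Lemma sqnorm_col_mx p q (u : 'cV[R]_p) (v : 'cV[R]_q) :
  sqnorm (col_mx u v) = sqnorm u + sqnorm v.
Proof.
rewrite /sqnorm big_split_ord /=.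
by congr (_ + _); apply: eq_bigr => i _; rewrite ?col_mxEu ?col_mxEd.
Qed.

Lemma quadform_tderiv m (P : 'M[R]_m) (v : R -> 'cV[R]_m) (dv : 'cV[R]_m) t0 :
  P^T = P ->
  (forall i, tderiv (fun t => v t i 0) t0 (dv i 0)) ->
  tderiv (fun t => quadform P (v t)) t0 (2 * (dv^T *m P *m v t0) 0 0).
Proof.
move=> sP vd; under eq_fun do rewrite quadformE.
have -> : 2 * (dv^T *m P *m v t0) 0 0 =
    \sum_i \sum_j P i j * (dv i 0 * v t0 j 0 + v t0 i 0 * dv j 0).
  rewrite mulr_natl mulr2n {1}(bilinC _ _ sP) addrC !bilinE -big_split.
  apply: eq_bigr => i _ /=; rewrite -big_split; apply: eq_bigr => j _ /=.
  by rewrite mulrDr.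
by apply: tderiv_sum => i; apply: tderiv_sum => j; apply/tderivZ/tderivM.
Qed.

Variables (a : R) (a0 : 0 <= a) (P : 'M[R]_(n + 2 + dimproj N)) (Rm Sm : 'M[R]_2).
Hypotheses (pP : posdef P) (pR : posdef Rm) (pS : posdef Sm).

(** In the integration by parts of the energy, the derivative of the exponential
    factor reproduces the energy itself, which gives the decay rate, and the
    growth of S + x R leaves the dissipation f^T R f that the Bessel inequality
    consumes. *)
Definition weight (x : R) : 'M[R]_2 := expR (a * x) *: (Sm + x *: Rm).

Definition lyapunov X f : R :=
  quadform P (col_mx X (Xi N f)) + energy weight f.

Lemma abscont_weight i j : abscont (fun x => weight x i j)
  (fun x => (a *: weight x + expR (a * x) *: Rm) i j).
Proof.
have := abscontM (abscont_expR a)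
  (abscontD (abscont_cst (Sm i j)) (abscontM (abscont_id R) (abscont_cst (Rm i j)))).
congr (abscont _ _); apply/funext => x; rewrite /weight !mxE//=; ring.
Qed.

Lemma weight_smooth : smooth_weight weight.
Proof. by move=> i j; eexists; exact: abscont_weight. Qed.

Lemma smooth_weight_exp (Q : 'M[R]_2) : smooth_weight (fun x => expR (a * x) *: Q).
Proof. exact/(smooth_weightM (abscont_expR a))/smooth_weight_cst. Qed.

Lemma quadform_weight x v : quadform (weight x) v =
  expR (a * x) * (quadform Sm v + x * quadform Rm v).
Proof. by rewrite quadformZ quadformD quadformZ. Qed.

Lemma expR_ge1 x : 0 <= x -> 1 <= expR (a * x).
Proof. by move=> x0; rewrite -expR0 ler_expR mulr_ge0. Qed.

Lemma lyapunov_ge : exists2 m : R, 0 < m &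
  forall X f, isL2 f -> m * Hnorm X f ^+ 2 <= lyapunov X f.
Proof.
have [p p0 hp] := posdef_coercive pP; have [s s0 hs] := posdef_coercive pS.
exists (Num.min p (2 * s)); first by rewrite lt_min p0 mulr_gt0.
move=> X f Lf; rewrite Hnorm_sqr//.
have : s * \sum_i inner (entry f i) (entry f i) <= energy weight f.
  rewrite -energy_scalar//; apply: energy_le => //.
  - exact: smooth_weight_cst.
  - exact: weight_smooth.
  move=> x v /andP[x0 _]; rewrite quadform_scalar quadform_weight.
  have := hs v; have := posdef_ge0 v pR; have := expR_ge1 x0.
  have := posdef_ge0 v pS.
  move: (expR _) (quadform _ _) (quadform _ _) (s * _) => e q r l q0 e1 r0 lq.
  have := mulr_ge0 x0 r0; move: (x * r) => y y0; nra.
have : p * sqnorm X <= quadform P (col_mx X (Xi N f)).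
  apply: le_trans (hp _); rewrite ler_pM2l// sqnorm_col_mx lerDl; exact: sqnorm_ge0.
rewrite /lyapunov.
have X0 := sqnorm_ge0 X.
have q0 : 0 <= \sum_i inner (entry f i) (entry f i).
  by apply: sumr_ge0 => i _; exact: inner_ge0.
have m1 : Num.min p (2 * s) <= p by rewrite ge_min lexx.
have m2 : Num.min p (2 * s) <= 2 * s by rewrite ge_min lexx orbT.
move: (Num.min _ _) (sqnorm X) (\sum_i _) (quadform _ _) (energy _ _) X0 q0 m1 m2.
move=> m u q y z u0 q0 m1 m2 yu zq; nra.
Qed.

Lemma lyapunov_le : exists2 M : R, 0 <= M &
  forall X f, isL2 f -> lyapunov X f <= M * Hnorm X f ^+ 2.
Proof.
pose C := \sum_i \sum_j `|P i j|.
pose K := \sum_(i < dimproj N) inner (leg (R := R) (tagnat.sig1 i)) (leg (tagnat.sig1 i)).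
pose D := expR a * (\sum_i \sum_j `|Sm i j| + \sum_i \sum_j `|Rm i j|).
have C0 : 0 <= C by apply: sumr_ge0 => i _; exact: sumr_ge0.
have K0 : 0 <= K by apply: sumr_ge0 => i _; exact: inner_ge0.
have S0 : 0 <= \sum_i \sum_j `|Sm i j| by apply: sumr_ge0 => i _; exact: sumr_ge0.
have R0 : 0 <= \sum_i \sum_j `|Rm i j| by apply: sumr_ge0 => i _; exact: sumr_ge0.
have D0 : 0 <= D by rewrite mulr_ge0 ?expR_ge0// addr_ge0.
exists (C + 2 * (C * K + D)); first by rewrite addr_ge0// mulr_ge0// addr_ge0// mulr_ge0.
move=> X f Lf; rewrite Hnorm_sqr//.
set q := \sum_i inner (entry f i) (entry f i).
have q0 : 0 <= q by apply: sumr_ge0 => i _; exact: inner_ge0.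
have hE : energy weight f <= D * q.
  rewrite -energy_scalar//; apply: energy_le => //.
  - exact: weight_smooth.
  - exact: smooth_weight_cst.
  move=> x v /andP[x0 x1]; rewrite quadform_scalar quadform_weight /D -mulrA.
  apply: ler_pM; rewrite ?expR_ge0//.
  - by rewrite addr_ge0 ?posdef_ge0// mulr_ge0// posdef_ge0.
  - by rewrite ler_expR ler_piMr.
  rewrite mulrDl; apply: lerD; first exact: quadform_le.
  apply: le_trans (quadform_le Rm v).
  by rewrite ler_piMl// posdef_ge0.
have hX : sqnorm (Xi N f) <= K * q.
  rewrite /sqnorm /K mulr_suml; apply: ler_sum => i _; rewrite Xi_entry.
  have Lfi := Lf (tagnat.sig2 i).
  apply: (le_trans (inner_CauchySchwarz Lfi (L2_leg R (tagnat.sig1 i)))).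
  rewrite mulrC ler_wpM2l ?inner_ge0//.
  rewrite /q (bigD1 (tagnat.sig2 i))//= lerDl.
  by apply: sumr_ge0 => j _; exact: inner_ge0.
have hP := quadform_le P (col_mx X (Xi N f)).
rewrite sqnorm_col_mx -/C in hP; rewrite /lyapunov.
have X0 := sqnorm_ge0 X.
move: (sqnorm X) (sqnorm (Xi N f)) (quadform _ _) (energy _ _) q X0 q0 hE hX hP.
move=> u w y z q u0 q0 hz hw hy.
have h1 := ler_wpM2l C0 hw.
have h2 : 0 <= (C * K + D) * u by rewrite mulr_ge0// addr_ge0// mulr_ge0.
have h3 : 0 <= C * q by rewrite mulr_ge0.
lra.
Qed.

End Lyapunov.

(** * Decay along trajectories *)

Section LyapunovDecay.
Variables (R : realType) (n N : nat) (c g k e1 alpha : R).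
Variables (Bc2 : 'M[R]_(n, 2)) (C1 : 'rV[R]_(n + 2)) (At : 'M[R]_(n + 2)).
Variables (P : 'M[R]_(n + 2 + dimproj N)) (Rm Sm : 'M[R]_2).
Hypotheses (c0 : 0 < c) (alpha0 : 0 <= alpha).
Hypotheses (pP : posdef P) (pR : posdef Rm).
Local Notation Bt := (tildeB e1 Bc2).
Hypothesis LMI : negdef (Psi_ c g k C1 At Bt alpha P Rm Sm - c *: R_ n N Rm).
Implicit Types (X : 'cV[R]_(n + 2)) (f df : R -> 'cV[R]_2).

Let a := 2 * alpha / c.
Let a0 : 0 <= a. Proof. by rewrite divr_ge0 ?mulr_ge0// ltW. Qed.
Local Notation W := (weight a Rm Sm).
Local Notation V := (lyapunov a P Rm Sm).

(** The time derivative of the functional at (X, f) in the direction (dX, df). *)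
Definition lyapunov_deriv X dX f df : R :=
  2 * ((col_mx dX (Xi N df))^T *m P *m col_mx X (Xi N f)) 0 0 +
  \sum_i \sum_j (inner (fun x => W x i j * entry df i x) (entry f j) +
                 inner (fun x => W x i j * entry f i x) (entry df j)).

Lemma lyapunov_tderiv (X dX : R -> 'cV[R]_(n + 2)) (chi chit : R -> R -> 'cV[R]_2) t0 :
  0 <= t0 -> (forall t, 0 <= t -> isL2 (chi t)) ->
  (forall t, 0 <= t -> isL2 (chit t)) -> Hderivative X dX chi chit ->
  tderiv (fun t => V (X t) (chi t)) t0
    (lyapunov_deriv (X t0) (dX t0) (chi t0) (chit t0)).
Proof.
move=> t00 Lc Lt Hd; have [dXi dchi] := Hderivative_components t00 Lc Lt Hd.
apply: tderivD; last by apply: energy_tderiv => //; exact: weight_smooth.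
apply: quadform_tderiv; first by case: pP.
move=> i; rewrite mxE; under eq_fun do rewrite mxE.
by case: (fintype.split i) => j; [exact: dXi|exact: Xi_tderiv].
Qed.

(** The terms match those of the matrix inequality after the Bessel inequality,
    the only estimates being that one and e^(a x) >= 1. *)
Lemma lyapunov_deriv_le X f fx : H1_deriv f fx -> boundary c g k C1 X f ->
  lyapunov_deriv X (At *m X + Bt *m col_mx (f 0) (f 1)) f (fun x => c *: fx x)
    + 2 * alpha * V X f <= 0.
Proof.
move=> Hf bd; have Lf := H1_isL2 Hf; have [Lfx _] := Hf.
pose xi : 'cV[R]_(dimxi n N) :=
  col_mx (col_mx X (Xi N f)) (midpoint (f 0) (f 1)).
have G_xi : G_ c g k C1 N *m xi = f 0 by exact: boundary_G.
have H_xi : H_ c g k C1 N *m xi = f 1 by exact: boundary_H.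
have F_xi : F_ R n N *m xi = col_mx X (Xi N f) by exact: F_augmented.
have Z_xi := Z_augmented e1 Bc2 At G_xi H_xi; rewrite -/xi in Z_xi.
have := LMI_decay xi pP.1 LMI.
rewrite G_xi H_xi F_xi Z_xi quadform_R -(Xi_space_derivative N Hf).
have -> : c *: Xi N fx = Xi N (fun x => c *: fx x).
  apply/matrixP => i j; rewrite ord1 scalemxE !Xi_entry -innerZl; last 2 first.
  - exact: Lfx.
  - exact: L2_leg.
  by apply: eq_inner => x _; rewrite /entry scalemxE.
rewrite /lyapunov_deriv /lyapunov; set dX := At *m X + _.
have -> : \sum_i \sum_j
      (inner (fun x => W x i j * entry (fun x => c *: fx x) i x) (entry f j) +
       inner (fun x => W x i j * entry f i x) (entry (fun x => c *: fx x) j)) =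
    c * (expR a * quadform (Sm + Rm) (f 1) - quadform Sm (f 0)
         - (a * energy W f + energy (fun x => expR (a * x) *: Rm) f)).
  have sW := weight_smooth a Rm Sm.
  have sE := smooth_weight_exp a Rm.
  rewrite -energyZ// -energyD//; last first.
    exact: (smooth_weightM (abscont_cst a)).
  have := energy_parts (abscont_weight a Rm Sm) Hf.
  have -> : W 1 = expR a *: (Sm + Rm) by rewrite /weight mulr1 scale1r.
  have -> : W 0 = Sm by rewrite /weight mulr0 expR0 scale1r scale0r addr0.
  rewrite quadformZ => <-.
  rewrite mulr_sumr; apply: eq_bigr => i _; rewrite mulr_sumr; apply: eq_bigr => j _.
  rewrite mulrDr -innerZl; [|exact: weight_L2|exact: Lf].
  rewrite -innerZr; [|exact: Lfx|exact: weight_L2].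
  by congr (_ + _); apply: eq_inner => x _; rewrite /entry (scalemxE c (fx x)); ring.
have hB : \sum_(i < N.+1) (2 * i + 1)%:R * quadform Rm (legendre_coef f i) <=
    energy (fun x => expR (a * x) *: Rm) f.
  apply: (le_trans (energy_bessel _ Lf (fun v => posdef_ge0 v pR))).
  apply: energy_le => //.
  - exact: smooth_weight_cst.
  - exact: smooth_weight_exp.
  move=> x v /andP[x0 _]; rewrite quadformZ ler_peMl ?posdef_ge0//.
  exact: expR_ge1.
have -> : ((col_mx dX (Xi N (fun x => c *: fx x)) + alpha *: col_mx X (Xi N f))^T *m P
     *m col_mx X (Xi N f)) 0 0 =
   ((col_mx dX (Xi N (fun x => c *: fx x)))^T *m P *m col_mx X (Xi N f)) 0 0 +
   alpha * quadform P (col_mx X (Xi N f)).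
  by rewrite linearD linearZ /= !mulmxDl -!scalemxAl addmxE scalemxE.
have ca : c * a = 2 * alpha by rewrite /a mulrC divfK// gt_eqF.
rewrite -/a.
have hc := ler_wpM2l (ltW c0) hB.
move: hc; move: (\sum_(i < N.+1) _) (energy (fun x => expR _ *: _) f) (energy W f)
  (quadform P _) (_ 0 0) (quadform Sm (f 0)) (quadform (Sm + Rm) (f 1)) (expR a).
move=> b E1 E2 q d r s e hc.
have -> : c * (e * s - r - (a * E2 + E1)) =
  c * e * s - c * r - (c * a) * E2 - c * E1 by ring.
rewrite ca; lra.
Qed.

(** The derivative only sees [df] through L2 pairings, so the transport equation
    may be used although it holds almost everywhere only. *)
Lemma lyapunov_deriv_ae X dX f df h : isL2 f -> isL2 df -> isL2 h ->
  {ae lebesgue_measure, forall x : R, x \in `]0, 1[ -> df x = c *: h x} ->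
  lyapunov_deriv X dX f df = lyapunov_deriv X dX f (fun x => c *: h x).
Proof.
move=> Lf Ldf Lh dfh.
have Lch : isL2 (fun x => c *: h x).
  move=> i; change (L2 (entry (fun x => c *: h x) i)).
  rewrite (_ : entry _ i = fun x => c * entry h i x); first exact: (L2Z _ (Lh i)).
  by apply/funext => x; rewrite /entry scalemxE.
have innerE i u : L2 u -> inner (entry df i) u = inner (entry (fun x => c *: h x) i) u.
  move=> Lu; rewrite (ae_inner i Ldf Lh Lu dfh) -(innerZl _ (Lh i) Lu).
  by apply: eq_inner => x _; rewrite /entry scalemxE.
have eXi : Xi N df = Xi N (fun x => c *: h x).
  by apply/matrixP => i j; rewrite ord1 !Xi_entry innerE//; exact: L2_leg.
have sW := weight_smooth a Rm Sm.
rewrite /lyapunov_deriv eXi; congr (_ + _).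
apply: eq_bigr => i _; apply: eq_bigr => j _; congr (_ + _).
  have move_weight u : inner (fun x => W x i j * u x) (entry f j) =
      inner u (fun x => W x i j * entry f j x).
    by apply: eq_inner => x _; ring.
  rewrite !move_weight innerE//.
  exact: (abscont_mul_L2 (abscont_weight a Rm Sm i j) (Lf j)).
rewrite !(innerC (fun x => W x i j * entry f i x)); apply: innerE.
exact: (weight_L2 i j sW Lf).
Qed.

End LyapunovDecay.

Theorem theorem1 (R : realType) (n : nat)
  (c g k A21 A22 b e1 : R) (hc : 0 < c)
  (Ac : 'M[R]_n) (Bc1 Bc2 : 'M[R]_(n, 2))
  (C1 : 'rV[R]_(n + 2)) (C2 : 'rV[R]_n) (K : 'rV[R]_2)
  (N : nat) (hN : (0 < N)%N) (alpha : R) (halpha : 0 <= alpha)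
  (hLMI : exists (P : 'M[R]_(n + 2 + dimproj N)) (Rm Sm : 'M[R]_2),
     [/\ posdef P, posdef Rm, posdef Sm
       & negdef (Psi_ c g k C1 (tildeA A21 A22 b Ac Bc1 C2 K) (tildeB e1 Bc2)
                   alpha P Rm Sm
                 - c *: R_ n N Rm)]) :
  exp_stable c g k C1 (tildeA A21 A22 b Ac Bc1 C2 K) (tildeB e1 Bc2) alpha.
Proof.
case: hLMI => P [Rm [Sm [pP pR pS LMI]]].
set a := 2 * alpha / c.
have a0 : 0 <= a by rewrite divr_ge0 ?mulr_ge0// ltW.
have [m m0 Vge] := lyapunov_ge a0 pP pR pS.
have [M M0 Vle] := lyapunov_le (N := N) a0 P pR pS.
exists (Num.max 1 (Num.sqrt (M / m))); first by rewrite le_max lexx.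
move=> X0 chi0 _ X chi [chi_x [chi_t [dX [[Hdom HH1] [Hd [Lt _]] pde ode]]]].
move=> eX0 echi0 t t0.
have Lc s : 0 <= s -> isL2 (chi s) by move=> s0; exact: H1_isL2 (HH1.1 s s0).
pose V s := lyapunov a P Rm Sm (X s) (chi s).
pose dV s := lyapunov_deriv c alpha P Rm Sm (X s) (dX s) (chi s) (chi_t s).
have decay : V t <= V 0 * expR (- (2 * alpha * t)).
  apply: (@exponential_decay R V dV) => // s s0.
    exact: lyapunov_tderiv.
  have s0' := ltW s0; have Hs := HH1.1 s s0'; have [_ bd] := Hdom s s0'.
  rewrite /dV (lyapunov_deriv_ae _ _ _ _ _ _ (Lc s s0') (Lt s s0') Hs.1 (pde s s0)).
  by rewrite (ode s s0'); exact: (lyapunov_deriv_le hc halpha pP pR LMI Hs bd).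
have Hnorm0 : Hnorm X0 chi0 = Hnorm (X 0) (chi 0).
  rewrite eX0 /Hnorm /L2norm; congr (Num.sqrt (_ + _ * Num.sqrt _ ^+ 2)).
  by apply: eq_Rintegral => x; rewrite inE/= in_itv/= => x01; rewrite echi0.
rewrite Hnorm0; set h0 := Hnorm (X 0) (chi 0).
have h00 : 0 <= h0 by exact: sqrtr_ge0.
have bound : Hnorm (X t) (chi t) ^+ 2 <= M / m * (h0 * expR (- (alpha * t))) ^+ 2.
  rewrite mulrAC ler_pdivlMr// mulrC; apply: (le_trans (Vge _ _ (Lc t t0))).
  apply: (le_trans decay); rewrite exprMn mulrA.
  have -> : expR (- (alpha * t)) ^+ 2 = expR (- (2 * alpha * t)).
    by rewrite -expRM_natl; congr expR; ring.
  by rewrite ler_wpM2r ?expR_ge0//; exact: Vle (Lc 0 (lexx 0)).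
have y0 : 0 <= h0 * expR (- (alpha * t)) by rewrite mulr_ge0 ?expR_ge0.
rewrite -mulrA; apply: (@le_trans _ _ (Num.sqrt (M / m) * (h0 * expR (- (alpha * t))))).
  rewrite -(ler_pXn2r (n := 2)) ?nnegrE ?sqrtr_ge0// ?mulr_ge0 ?sqrtr_ge0//.
  have Mm : 0 <= M / m by rewrite divr_ge0// ltW.
  by rewrite exprMn (sqr_sqrtr Mm).
by rewrite ler_wpM2r// le_max lexx orbT.
Qed.
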